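(* Let $n\geq 1$ be an integer, let $\Gamma = H\wr_X G$ be a (permutational restricted) wreath product of type $FP_n$, and let $\chi:\Gamma\to\mathbb{R}$ be a character. Let $$T_\chi = \{x\in X\mid \chi|_{H_x}\neq 0\}.$$ If $T_\chi$ has at least $n+1$ elements, then $[\chi]\in\Sigma^n(\Gamma,\mathbb{Z})$.
   Context: For a group $G$ acting on a set $X$ and a group $H$, the (permutational restricted) wreath product is $H\wr_X G = (\bigoplus_{x\in X}H_x)\rtimes G$, where each $H_x$ is a copy of $H$ and $G$ acts by conjugation on $\bigoplus_{x\in X}H_x$ by permuting the copies of $H$ via the given action on $X$. For an associative ring $R$, an $R$-module $A$ is of type $FP_n$ over $R$ if it has a projective resolution over $R$ in which all projectives in dimensions $\leq n$ are finitely generated; a group $G$ is of type $FP_n$ if the trivial $\mathbb{Z}G$-module $\mathbb{Z}$ is of type $FP_n$ over $\mathbb{Z}G$. Modules are left modules. A character of a group $G$ is a non-zero group homomorphism $\chi: G \to \mathbb{R}$. For a finitely generated group $G$, the character sphere $S(G)$ is the set of classes $[\chi]$ of characters of $G$, where two characters are equivalent if one is a positive real multiple of the other. Put $G_\chi = \{g \in G \mid \chi(g) \geq 0\}$ (a submonoid of $G$). Then $\Sigma^n(G,\mathbb{Z}) = \{[\chi] \in S(G) \mid \text{the trivial module } \mathbb{Z} \text{ is of type } FP_n \text{ over the monoid ring } \mathbb{Z}G_\chi\}$. *)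

(* Defs.v *)
From HB Require Import structures.
From mathcomp Require Import all_boot all_order all_algebra finmap.
From mathcomp Require Import boolp classical_sets cardinality reals.
From mathcomp.multinomials Require Import monalg.

Set Implicit Arguments.
Unset Strict Implicit.
Unset Printing Implicit Defensive.

Import Order.TTheory GRing.Theory Num.Theory.

Local Open Scope classical_set_scope.
Local Open Scope ring_scope.

Section ModulesOfTypeFP.
Variable R : pzRingType.
Implicit Types P A B C : lmodType R.

Definition finitely_generated A : Prop :=
  exists (m : nat) (e : 'I_m -> A),
    forall v : A, exists a : 'I_m -> R, v = \sum_(i < m) a i *: e i.

Definition projective P : Prop :=
  forall B C (g : {linear B -> C}) (f : {linear P -> C}),
    (forall c, exists b, g b = c) ->
    exists h : {linear P -> B}, forall x, g (h x) = f x.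

Record projective_resolution A := ProjRes {
  pr_obj :> nat -> lmodType R;
  pr_diff : forall i, {linear pr_obj i.+1 -> pr_obj i};
  pr_aug : {linear pr_obj 0%N -> A};
  pr_proj : forall i, projective (pr_obj i);
  pr_augS : forall a, exists x, pr_aug x = a;
  pr_exact0 : forall x, pr_aug x = 0 <-> exists y, pr_diff 0 y = x;
  pr_exactS : forall i x, pr_diff i x = 0 <-> exists y, pr_diff i.+1 y = x
}.

Definition type_FP (n : nat) A : Prop :=
  exists P : projective_resolution A,
    forall i, (i <= n)%N -> finitely_generated (P i).

End ModulesOfTypeFP.

(* monalg only makes {malg int[M]} a ring when 1 is the sole invertible element
   of M, so the convolution product is redefined here on an alias. *)
Definition monoid_ring (M : monoidType) : Type := {malg int[M]}.

Section MonoidRing.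
Variable M : monoidType.
Local Notation ZM := (monoid_ring M).
Implicit Types p q r : ZM.

HB.instance Definition _ := GRing.Zmodule.copy ZM {malg int[M]}.

Definition mr_one : ZM := << 1 *g 1%g >>.

Definition mr_mul p q : ZM :=
  \sum_(k <- msupp p) \sum_(l <- msupp q) << p@_k * q@_l *g (k * l)%g >>.

Lemma mr_mulw (d e : {fset M}) p q :
  (msupp p `<=` d)%fset -> (msupp q `<=` e)%fset ->
  mr_mul p q = \sum_(k <- d) \sum_(l <- e) << p@_k * q@_l *g (k * l)%g >>.
Proof.
move=> pd qe; rewrite /mr_mul (big_fset_incl _ pd) /=; last first.
  move=> k _ /mcoeff_outdom pk.
  by rewrite big1 // => l _; rewrite pk mul0r monalgU0.
apply/eq_bigr=> k _; apply/big_fset_incl => // l _ /mcoeff_outdom ->.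
by rewrite mulr0 monalgU0.
Qed.

Lemma mr_mulDl : left_distributive mr_mul +%R.
Proof.
move=> p q r; rewrite (mr_mulw (msuppD_le p q) (fsubset_refl (msupp r))).
rewrite (mr_mulw (fsubsetUl _ (msupp q)) (fsubset_refl (msupp r))).
rewrite (mr_mulw (fsubsetUr (msupp p) _) (fsubset_refl (msupp r))).
rewrite -big_split /=; apply/eq_bigr=> k _.
rewrite -big_split /=; apply/eq_bigr=> l _.
by rewrite mcoeffD mulrDl monalgUD.
Qed.

Lemma mr_mulDr : right_distributive mr_mul +%R.
Proof.
move=> r p q; rewrite (mr_mulw (fsubset_refl (msupp r)) (msuppD_le p q)).
rewrite (mr_mulw (fsubset_refl (msupp r)) (fsubsetUl _ (msupp q))).
rewrite (mr_mulw (fsubset_refl (msupp r)) (fsubsetUr (msupp p) _)).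
rewrite -big_split /=; apply/eq_bigr=> k _.
rewrite -big_split /=; apply/eq_bigr=> l _.
by rewrite mcoeffD mulrDr monalgUD.
Qed.

Lemma mr_mul0r : left_zero 0 mr_mul.
Proof. by move=> p; rewrite /mr_mul msupp0 big_seq_fset0. Qed.

Lemma mr_mulr0 : right_zero 0 mr_mul.
Proof.
by move=> p; rewrite /mr_mul big1 // => k _; rewrite msupp0 big_seq_fset0.
Qed.

Lemma mr_mulUU (a b : int) (k l : M) :
  mr_mul << a *g k >> << b *g l >> = << a * b *g (k * l)%g >>.
Proof. by rewrite (mr_mulw msuppU_le msuppU_le) !big_seq_fset1 !mcoeffUU. Qed.

Lemma mr_ind (P : ZM -> Prop) :
  P 0 -> (forall p q, P p -> P q -> P (p + q)) ->
  (forall (a : int) (k : M), P << a *g k >>) -> forall p, P p.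
Proof. by move=> P0 PD PU p; rewrite (monalgE p); apply: big_ind. Qed.

Lemma mr_mulA : associative mr_mul.
Proof.
move=> p q r; elim/mr_ind: p => [|p p' IH IH'|a k].
- by rewrite !mr_mul0r.
- by rewrite !mr_mulDl IH IH'.
elim/mr_ind: q => [|q q' IH IH'|b l].
- by rewrite mr_mul0r !mr_mulr0 mr_mul0r.
- by rewrite mr_mulDl !mr_mulDr mr_mulDl IH IH'.
elim/mr_ind: r => [|r r' IH IH'|c m].
- by rewrite !mr_mulr0.
- by rewrite !mr_mulDr IH IH'.
by rewrite !mr_mulUU mulrA mulgA.
Qed.

Lemma mr_mul1r : left_id mr_one mr_mul.
Proof.
elim/mr_ind => [|p q IH IH'|a k]; first by rewrite mr_mulr0.
  by rewrite mr_mulDr IH IH'.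
by rewrite mr_mulUU mul1r mul1g.
Qed.

Lemma mr_mulr1 : right_id mr_one mr_mul.
Proof.
elim/mr_ind => [|p q IH IH'|a k]; first by rewrite mr_mul0r.
  by rewrite mr_mulDl IH IH'.
by rewrite mr_mulUU mulr1 mulg1.
Qed.

Lemma mr_oner_neq0 : mr_one != 0.
Proof. by rewrite monalgU_eq0 oner_eq0. Qed.

HB.instance Definition _ := GRing.Zmodule_isNzRing.Build ZM
  mr_mulA mr_mul1r mr_mulr1 mr_mulDl mr_mulDr mr_oner_neq0.

Definition augmentation p : int := \sum_(k <- msupp p) p@_k.

Lemma augmentationw (d : {fset M}) p :
  (msupp p `<=` d)%fset -> augmentation p = \sum_(k <- d) p@_k.
Proof. by move=> pd; apply/big_fset_incl => // k _ /mcoeff_outdom. Qed.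

Lemma augmentationD : {morph augmentation : p q / p + q}.
Proof.
move=> p q; rewrite (augmentationw (msuppD_le p q)).
rewrite (augmentationw (fsubsetUl _ (msupp q))).
rewrite (augmentationw (fsubsetUr (msupp p) _)).
by rewrite -big_split /=; apply/eq_bigr=> k _; rewrite mcoeffD.
Qed.

Lemma augmentation0 : augmentation 0 = 0.
Proof. by rewrite /augmentation msupp0 big_seq_fset0. Qed.

Lemma augmentationU (a : int) (k : M) : augmentation << a *g k >> = a.
Proof. by rewrite (augmentationw msuppU_le) big_seq_fset1 mcoeffUU. Qed.

Lemma augmentation1 : augmentation 1 = 1.
Proof. exact: augmentationU. Qed.

Lemma augmentationM : {morph augmentation : p q / p * q}.
Proof.
move=> p q; elim/mr_ind: p => [|p p' IH IH'|a k].
- by rewrite mul0r augmentation0 mul0r.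
- by rewrite mulrDl !augmentationD mulrDl IH IH'.
elim/mr_ind: q => [|q q' IH IH'|b l].
- by rewrite mulr0 augmentation0 mulr0.
- by rewrite mulrDr !augmentationD mulrDr IH IH'.
by rewrite [_ * _ in LHS]mr_mulUU !augmentationU.
Qed.

End MonoidRing.

(* The trivial module Z over Z[M]: every k : M acts as the identity. *)
Definition trivial_module (M : monoidType) : Type := int.

Section TrivialModule.
Variable M : monoidType.
Local Notation ZM := (monoid_ring M).
Local Notation Ztriv := (trivial_module M).

HB.instance Definition _ := GRing.Zmodule.copy Ztriv int.

Definition triv_scale (p : ZM) (z : Ztriv) : Ztriv :=
  augmentation p * (z : int).

Lemma triv_scaleA p q z :
  triv_scale p (triv_scale q z) = triv_scale (p * q) z.
Proof. by rewrite /triv_scale augmentationM mulrA. Qed.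

Lemma triv_scale1 : left_id 1 triv_scale.
Proof. by move=> z; rewrite /triv_scale augmentation1 mul1r. Qed.

Lemma triv_scaleDr : right_distributive triv_scale +%R.
Proof. by move=> p y z; apply: mulrDr. Qed.

Lemma triv_scaleDl z : {morph triv_scale^~ z : p q / p + q}.
Proof. by move=> p q; rewrite /triv_scale augmentationD mulrDl. Qed.

HB.instance Definition _ := GRing.Zmodule_isLmodule.Build ZM Ztriv
  triv_scaleA triv_scale1 triv_scaleDr triv_scaleDl.

Lemma triv_scaleU (k : M) (z : Ztriv) : (<< k >> : ZM) *: z = z.
Proof. by rewrite /GRing.scale /= /triv_scale augmentationU mul1r. Qed.

End TrivialModule.

Definition group_type_FP (n : nat) (G : groupType) : Prop :=
  type_FP n (trivial_module G : lmodType (monoid_ring G)).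

Record character (G : groupType) (R : realType) := Character {
  char_fun :> G -> R;
  charM : forall g h, char_fun (g * h)%g = char_fun g + char_fun h;
  char_neq0 : exists g, char_fun g != 0
}.

Section Sigma.
Variables (G : groupType) (R : realType).
Implicit Types chi psi : character G R.

Definition char_class chi : set (character G R) :=
  [set psi | exists2 r : R, 0 < r & forall g, psi g = r * chi g].

Definition char_sphere : set (set (character G R)) := range char_class.

Definition char_nonneg chi : pred G := [pred g | 0 <= chi g].

Lemma char_nonneg_closed chi : monoid_closed (char_nonneg chi).
Proof.
split=> [|g h]; rewrite !inE; last by rewrite charM; apply: addr_ge0.
have := charM chi 1%g 1%g; rewrite mulg1 => /eqP.
by rewrite -subr_eq subrr eq_sym => /eqP->.
Qed.

Definition char_monoid chi : Type := {g : G | char_nonneg chi g}.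

HB.instance Definition _ chi := SubChoice.on (char_monoid chi).
HB.instance Definition _ chi := SubChoice_isSubMonoid.Build
  G (char_nonneg chi) (char_monoid chi) (char_nonneg_closed chi).

(* The condition does not depend on the representative chi of the class, since
   positive multiples of chi define the same submonoid of G. *)
Definition Sigma (n : nat) : set (set (character G R)) :=
  [set c | char_sphere c /\ exists2 chi, c = char_class chi &
     type_FP n (trivial_module (char_monoid chi)
                  : lmodType (monoid_ring (char_monoid chi)))].

End Sigma.

Definition direct_sum (X : choiceType) (H : groupType) : Type :=
  {fsfun X -> H with 1%g}.

Section DirectSum.
Variables (X : choiceType) (H : groupType).
Local Notation S := (direct_sum X H).
Implicit Types u v w : S.

HB.instance Definition _ := Choice.copy S {fsfun X -> H with 1%g}.

Definition ds_one : S := [fsfun with 1%g].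
Definition ds_mul u v : S :=
  [fsfun x in (finsupp u `|` finsupp v)%fset => (u x * v x)%g].
Definition ds_inv u : S := [fsfun x in finsupp u => ((u x)^-1)%g].

Lemma ds_oneE x : ds_one x = 1%g.
Proof. exact: fsfun0E. Qed.

Lemma ds_mulE u v x : ds_mul u v x = (u x * v x)%g.
Proof.
rewrite fsfun_fun in_fsetU.
by case: finsuppP => _; case: finsuppP => _ //=; rewrite mulg1.
Qed.

Lemma ds_invE u x : ds_inv u x = ((u x)^-1)%g.
Proof. by rewrite fsfun_fun; case: finsuppP => _; rewrite ?invg1. Qed.

Lemma ds_mulA : associative ds_mul.
Proof. by move=> u v w; apply/fsfunP=> x; rewrite !ds_mulE mulgA. Qed.

Lemma ds_mul1g : left_id ds_one ds_mul.
Proof. by move=> u; apply/fsfunP=> x; rewrite ds_mulE ds_oneE mul1g. Qed.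

Lemma ds_mulg1 : right_id ds_one ds_mul.
Proof. by move=> u; apply/fsfunP=> x; rewrite ds_mulE ds_oneE mulg1. Qed.

Lemma ds_mulVg : left_inverse ds_one ds_inv ds_mul.
Proof.
by move=> u; apply/fsfunP=> x; rewrite ds_mulE ds_invE ds_oneE mulVg.
Qed.

Lemma ds_mulgV : right_inverse ds_one ds_inv ds_mul.
Proof.
by move=> u; apply/fsfunP=> x; rewrite ds_mulE ds_invE ds_oneE mulgV.
Qed.

HB.instance Definition _ :=
  isGroup.Build S ds_mulA ds_mul1g ds_mulg1 ds_mulVg ds_mulgV.

Definition ds_inj (x : X) (h : H) : S := [fsfun ds_one with x |-> h].

End DirectSum.

Record gaction (G : groupType) (X : Type) := GAction {
  gact :> G -> X -> X;
  gact1 : forall x, gact 1%g x = x;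
  gactM : forall g h x, gact (g * h)%g x = gact g (gact h x)
}.

(* Elements of the semidirect product direct_sum X H >| G, as pairs (u, g)
   standing for the product u g. *)
Record wreath (H G : groupType) (X : choiceType) (a : gaction G X) := Wreath {
  wr_base : direct_sum X H;
  wr_top : G
}.

Section Wreath.
Variables (H G : groupType) (X : choiceType) (a : gaction G X).
Local Notation W := (wreath H a).
Implicit Types s t : W.

Definition wr_pair s := (wr_base s, wr_top s).
Definition pair_wr (p : direct_sum X H * G) : W := Wreath a p.1 p.2.
Lemma wr_pairK : cancel wr_pair pair_wr. Proof. by case. Qed.
HB.instance Definition _ := Choice.copy W (can_type wr_pairK).

(* The action of g maps the copy of H at x onto the copy at g x. *)
Definition ds_act (g : G) (u : direct_sum X H) : direct_sum X H :=
  [fsfun x in [fset a g y | y in finsupp u]%fset => u (a (g^-1)%g x)].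

Definition wr_one : W := Wreath a 1%g 1%g.
Definition wr_mul s t : W :=
  Wreath a (wr_base s * ds_act (wr_top s) (wr_base t))%g
           (wr_top s * wr_top t)%g.
Definition wr_inv s : W :=
  Wreath a (ds_act (wr_top s)^-1 (wr_base s)^-1)%g ((wr_top s)^-1)%g.

Lemma gactK g : cancel (a g) (a (g^-1)%g).
Proof. by move=> x; rewrite -gactM mulVg gact1. Qed.

Lemma gactVK g : cancel (a (g^-1)%g) (a g).
Proof. by move=> x; rewrite -gactM mulgV gact1. Qed.

Lemma ds_actE g u x : ds_act g u x = u (a (g^-1)%g x).
Proof.
rewrite fsfun_fun; case: ifPn => // /imfsetP xNu.
rewrite fsfun_dflt //; apply/negP => ux; apply: xNu.
by exists (a (g^-1)%g x); rewrite ?gactVK.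
Qed.

Lemma ds_act1 u : ds_act 1%g u = u.
Proof. by apply/fsfunP=> x; rewrite ds_actE invg1 gact1. Qed.

Lemma ds_actM g h u : ds_act (g * h)%g u = ds_act g (ds_act h u).
Proof. by apply/fsfunP=> x; rewrite !ds_actE invgM gactM. Qed.

Lemma ds_act_mul g : {morph ds_act g : u v / (u * v)%g}.
Proof.
by move=> u v; apply/fsfunP=> x; rewrite ds_actE !ds_mulE !ds_actE.
Qed.

Lemma ds_act_one g : ds_act g 1%g = 1%g.
Proof. by apply/fsfunP=> x; rewrite ds_actE !ds_oneE. Qed.

Lemma wr_mulA : associative wr_mul.
Proof.
by move=> r s t; rewrite /wr_mul /= ds_act_mul ds_actM !mulgA.
Qed.

Lemma wr_mul1g : left_id wr_one wr_mul.
Proof. by case=> u g; rewrite /wr_mul /= ds_act1 !mul1g. Qed.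

Lemma wr_mulg1 : right_id wr_one wr_mul.
Proof. by case=> u g; rewrite /wr_mul /= ds_act_one !mulg1. Qed.

Lemma wr_mulVg : left_inverse wr_one wr_inv wr_mul.
Proof.
by case=> u g; rewrite /wr_mul /= -ds_act_mul !mulVg ds_act_one.
Qed.

Lemma wr_mulgV : right_inverse wr_one wr_inv wr_mul.
Proof.
by case=> u g; rewrite /wr_mul /= -ds_actM !mulgV ds_act1 mulgV.
Qed.

HB.instance Definition _ :=
  isGroup.Build W wr_mulA wr_mul1g wr_mulg1 wr_mulVg wr_mulgV.

(* The inclusion of H_x, the copy of H at x. *)
Definition wr_copy (x : X) (h : H) : W := Wreath a (ds_inj x h) 1%g.

Lemma wr_copyM x : {morph wr_copy x : h k / (h * k)%g}.
Proof.
move=> h k; congr Wreath; last by rewrite /= mulg1.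
apply/fsfunP=> y; rewrite /= ds_mulE ds_act1 !fsfun_withE.
by case: eqP; rewrite ?ds_oneE ?mulg1.
Qed.

Lemma wr_copyJ (g : G) x h :
  (Wreath a 1 g * wr_copy x h * (Wreath a 1 g)^-1 = wr_copy (a g x) h)%g.
Proof.
congr Wreath; last by rewrite /= mulg1 mulgV.
rewrite /= mul1g invg1 !ds_act_one mulg1; apply/fsfunP=> y.
rewrite ds_actE !fsfun_withE !ds_oneE.
by rewrite (can2_eq (gactVK g) (gactK g)).
Qed.

Definition wr_char_support (R : realType) (chi : character W R) : set X :=
  [set x | exists h : H, chi (wr_copy x h) != 0].

End Wreath.

(* Main.v *)
Require Import Defs.
From HB Require Import structures.
From mathcomp Require Import all_boot all_order all_algebra finmap.
From mathcomp Require Import boolp classical_sets functions cardinality reals.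
From mathcomp.multinomials Require Import monalg.

Set Implicit Arguments.
Unset Strict Implicit.
Unset Printing Implicit Defensive.

Import Order.TTheory GRing.Theory Num.Theory.

Local Open Scope card_scope.
Local Open Scope classical_set_scope.
Local Open Scope ring_scope.

(** Why the theorem holds.

    Write T for the group, S for the set of those elements of the copies of H
    on which chi is positive, and M for the monoid of elements with chi >= 0.
    Choose y_0, ..., y_n in S in n+1 distinct copies.  Conjugation permutes S,
    elements of distinct copies commute, and so every word of length at most n
    in S misses the copy of some y_k, which then commutes with all its letters.
    Only these facts are used ([commuting_colours_type_FP]).

    First, Ext^i_{Z[T]}(Z, D) = 0 for i <= n whenever 1 - s acts bijectively
    on D for all s in S ([Ext_vanishing]).  Consider the semi-simplicial set
    whose simplices are the words of pairwise commuting letters of S.  It is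
    acyclic in the range needed: for a word that misses colour k one can insert
    y_k in front, and these partial cones, used for k = 0, ..., n in turn, kill
    every cocycle on words of length at most n ([cochain_exact]).  On the other
    hand the stabiliser of a nonempty word contains its first letter s in its
    centre; multiplication by s on a resolution is homotopic to the identity,
    so 1 - s acts as zero on the cohomology of the stabiliser with coefficients
    in D, where it is also invertible: that cohomology vanishes ([vertical]).
    A double complex chase combines the two ([cocycle_descent]).

    Second, this is applied to the module D of additive maps from sequences in
    Z[T] to an abelian group that kill the sequences whose supports lie in a
    common half space chi >= -c.  On such germs of sequences geometric sums
    invert 1 - s ([germ_module_bij]).  It follows that, in a resolution F of Z
    over Z[T] by free modules of finite rank up to degree n, the cycles of F_i
    (i < n) supported in a given half space bound chains supported in one other
    half space, the same for all of them ([uniform_lifting]): otherwise a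
    sequence of worse and worse cycles would give a nonzero germ.

    Third, let Q be a resolution of Z over Z[M] that is finitely generated up to
    degree k < n.  The chains of F supported in suitable half spaces, one per
    degree and depending on Q, form a complex of finitely generated free
    Z[M]-modules up to degree k+1, to which Q maps, and in which the images of
    the k-cycles of Q bound.  Comparing the two complexes in both directions
    shows that the k-cycles of Q are finitely generated ([comparison_fg]), so Q
    can be chosen finitely generated in degree k+1, and finally up to degree n
    ([type_FP_char_monoid]). *)

(** * Lifting properties and finitely generated resolutions *)

(** Builds a chain map or a homotopy degree by degree.  The relation at stage i
    is only guaranteed when it can be satisfied, so that its solvability may be
    proved afterwards, by an induction that uses the earlier stages. *)
Lemma staged_choice (T : nat -> Type) (x0 : T 0%N)
    (r : forall i, T i -> T i.+1 -> Prop) :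
  (forall i, T i.+1) ->
  exists x : forall i, T i, x 0%N = x0 /\
    forall i, (exists y, r i (x i) y) -> r i (x i) (x i.+1).
Proof.
move=> inh.
have next i (u : T i) : {v | (exists y, r i u y) -> r i u v}.
  apply/cid; have [[v uv]|nv] := pselect (exists y, r i u y); first by exists v.
  by exists (inh i).
exists (nat_rect T x0 (fun i u => sval (next i u))); split=> // i ri.
exact: (svalP (next i _) ri).
Qed.

Lemma linear_span (R : pzRingType) (X Y : lmodType R) (f : {linear X -> Y})
    (m : nat) (a : 'I_m -> R) (e : 'I_m -> X) :
  f (\sum_i a i *: e i) = \sum_i a i *: f (e i).
Proof. by rewrite linear_sum; apply: eq_bigr => i _; rewrite linearZ. Qed.

Section Lifting.
Variable R : nzRingType.
Implicit Types A P Q X Y : lmodType R.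

(** Lifting only requires that the values of f are hit by g, not that g is
    onto.  It is the form in which projectivity is applied to a map into the
    kernel of a differential, and it spares the construction of kernels as
    modules. *)
Definition lifting P := forall X Y (g : {linear X -> Y}) (f : {linear P -> Y}),
  (forall p, exists x, g x = f p) ->
  exists h : {linear P -> X}, forall p, g (h p) = f p.

Lemma lifting_projective P : lifting P -> projective P.
Proof.
move=> liftP B C g f gS.
by apply: liftP => p; apply: gS.
Qed.

Definition lincomb X m (e : 'I_m -> X) (v : 'rV[R]_m) : X :=
  \sum_i v 0 i *: e i.

Lemma lincomb_is_linear X m (e : 'I_m -> X) : linear (lincomb e).
Proof.
move=> a u v; rewrite /lincomb scaler_sumr -big_split /=.
by apply: eq_bigr => i _; rewrite !mxE scalerDl scalerA.
Qed.

HB.instance Definition _ X m (e : 'I_m -> X) :=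
  GRing.isLinear.Build R 'rV[R]_m X _ (lincomb e) (lincomb_is_linear e).

Lemma lincomb_row X m (f : {linear 'rV[R]_m -> X}) v :
  f v = lincomb (fun i => f (delta_mx 0 i)) v.
Proof.
by rewrite {1}(row_sum_delta v) linear_sum; apply: eq_bigr => i _; rewrite linearZ.
Qed.

Lemma lifting_row m : lifting 'rV[R]_m.
Proof.
move=> X Y g f fg.
have [e ge] := choice (fun i => fg (delta_mx 0 i)).
exists (lincomb e) => v; rewrite [RHS]lincomb_row linear_sum.
by apply: eq_bigr => i _; rewrite linearZ ge.
Qed.

(** A finitely generated projective module is a retract of a row module. *)
Lemma lifting_fg_projective P :
  finitely_generated P -> projective P -> lifting P.
Proof.
move=> [m [e spanP]] projP X Y g f fg.
have [|s se] := projP _ _ (lincomb e) (idfun : {linear P -> P}).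
  move=> p; have [a ->] := spanP p; exists (\row_i a i).
  by apply: eq_bigr => i _; rewrite mxE.
have [|h gh] := @lifting_row m _ _ g (f \o lincomb e).
  by move=> v; apply: fg.
by exists (h \o s) => p; rewrite /= gh /= se.
Qed.

Definition free_lift (K : choiceType) X (e : K -> X) (p : {malg R[K]}) : X :=
  \sum_(k <- msupp p) p@_k *: e k.

Lemma free_liftw (K : choiceType) X (e : K -> X) (d : {fset K})
    (p : {malg R[K]}) :
  (msupp p `<=` d)%fset -> free_lift e p = \sum_(k <- d) p@_k *: e k.
Proof.
move=> pd; apply: big_fset_incl => // k _ /mcoeff_outdom ->.
by rewrite scale0r.
Qed.

Lemma free_lift_is_linear (K : choiceType) X (e : K -> X) :
  linear (free_lift e).
Proof.
move=> a p q; pose d := (msupp p `|` msupp q)%fset.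
rewrite (@free_liftw _ _ _ d p) ?fsubsetUl // (@free_liftw _ _ _ d q) ?fsubsetUr //.
rewrite (@free_liftw _ _ _ d); last first.
  apply: fsubset_trans (msuppD_le _ _) _.
  by apply: fsetUSS => //; apply: msuppZ_le.
rewrite scaler_sumr -big_split /=; apply: eq_bigr => k _.
by rewrite mcoeffD mcoeffZ scalerDl scalerA.
Qed.

HB.instance Definition _ (K : choiceType) X (e : K -> X) :=
  GRing.isLinear.Build R {malg R[K]} X _ (free_lift e) (free_lift_is_linear e).

Lemma free_liftU (K : choiceType) X (e : K -> X) k : free_lift e << k >> = e k.
Proof.
by rewrite (free_liftw e msuppU_le) big_seq_fset1 mcoeffUU scale1r.
Qed.

Lemma lifting_free (K : choiceType) : lifting {malg R[K]}.
Proof.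
move=> X Y g f fg.
have [e ge] := choice (fun k => fg << k >>).
exists (free_lift e) => p; rewrite linear_sum [in RHS](monalgE p) linear_sum.
apply: eq_bigr => k _; rewrite linearZ ge -linearZ /=.
by congr (f _); apply/malgP=> l; rewrite mcoeffZ !mcoeffU mulr_natr.
Qed.

Definition fg_ker P Q (f : {linear P -> Q}) :=
  exists (m : nat) (e : 'I_m -> P), (forall i, f (e i) = 0) /\
    forall x, f x = 0 -> exists a : 'I_m -> R, x = \sum_i a i *: e i.

Definition fin_free P := exists (m : nat) (u : {linear P -> 'rV[R]_m})
  (v : {linear 'rV[R]_m -> P}), cancel u v /\ cancel v u.

Lemma fin_free_fg P : fin_free P -> finitely_generated P.
Proof.
move=> [m [u [v [uK _]]]]; exists m, (fun i => v (delta_mx 0 i)) => p.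
by exists (u p 0); rewrite -{1}(uK p) lincomb_row.
Qed.

(** When the kernel is not finitely generated, take the free module on all of P,
    with the generators outside the kernel sent to 0. *)
Lemma ker_cover P Q (f : {linear P -> Q}) :
  exists (X : lmodType R) (c : {linear X -> P}),
    [/\ forall y, f y = 0 <-> exists x, c x = y, lifting X
      & fg_ker f -> fin_free X].
Proof.
have [[m [e [fe gen]]]|nfg] := pselect (fg_ker f).
  exists 'rV[R]_m, (lincomb e); split; [|exact: lifting_row|].
    move=> y; split=> [/gen[a ->]|[v <-]].
      by exists (\row_i a i); apply: eq_bigr => i _; rewrite mxE.
    by rewrite linear_sum big1 // => i _; rewrite linearZ fe /= scaler0.
  by move=> _; exists m, idfun, idfun.
pose e y := if f y == 0 then y else 0.
have fe y : f (e y) = 0 by rewrite /e; case: eqP => // _; rewrite linear0.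
exists {malg R[P]}, (free_lift e); split=> //; last exact: lifting_free.
move=> y; split=> [fy|[x <-]].
  by exists << y >>; rewrite /= free_liftU /e fy eqxx.
by rewrite linear_sum big1 // => k _; rewrite linearZ fe /= scaler0.
Qed.

Record arrow := Arrow {
  arr_src : lmodType R;
  arr_tgt : lmodType R;
  arr :> {linear arr_src -> arr_tgt}
}.

Definition cover_arrow (f : arrow) : {g : {X : lmodType R & {linear X -> arr_src f}} |
  [/\ forall y, f y = 0 <-> exists x, projT2 g x = y, lifting (projT1 g)
    & fg_ker f -> fin_free (projT1 g)]}.
Proof.
by apply: cid; have [X [c Xc]] := ker_cover f; exists (existT _ X c).
Qed.

(** The resolution of A in which every module is a row module as soon as the
    kernel to be covered is finitely generated.  It is augmented: the object 0 is
    A, and the object i+1 is the projective module of degree i.  Stage 0 is the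
    zero map of A, whose kernel is A. *)
Fixpoint can_arrow A (i : nat) : arrow :=
  if i is i'.+1 then Arrow (projT2 (sval (cover_arrow (can_arrow A i'))))
  else Arrow (\0 : {linear A -> A}).

Definition can_obj A i := arr_src (can_arrow A i).

Definition can_diff A i : {linear can_obj A i.+1 -> can_obj A i} :=
  arr (can_arrow A i.+1).

Lemma can_diff0S A (a : A) : exists x, can_diff A 0 x = a.
Proof. by case: (svalP (cover_arrow (can_arrow A 0))) => + _ _; case/(_ a) => + _; apply. Qed.

Lemma can_exact A i x :
  can_diff A i x = 0 <-> exists y, can_diff A i.+1 y = x.
Proof. by case: (svalP (cover_arrow (can_arrow A i.+1))). Qed.

Lemma can_lifting A i : lifting (can_obj A i.+1).
Proof. by case: (svalP (cover_arrow (can_arrow A i))). Qed.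

Lemma can_fin_freeS A i : fg_ker (can_diff A i) -> fin_free (can_obj A i.+2).
Proof. by case: (svalP (cover_arrow (can_arrow A i.+1))). Qed.

Lemma can_fin_free0 A : finitely_generated A -> fin_free (can_obj A 1).
Proof.
move=> [m [e gen]]; case: (svalP (cover_arrow (can_arrow A 0))) => _ _; apply.
by exists m, e.
Qed.

Lemma can_type_FP n A :
  (forall i, (i <= n)%N -> fin_free (can_obj A i.+1)) -> type_FP n A.
Proof.
move=> fin.
exists (@ProjRes R A (fun i => can_obj A i.+1) (fun i => can_diff A i.+1)
  (can_diff A 0) (fun i => lifting_projective (@can_lifting A i))
  (@can_diff0S A) (@can_exact A 0) (fun i => @can_exact A i.+1)) => i /fin.
exact: fin_free_fg.
Qed.

(** Brown's finiteness criterion in one degree.  Let be : C -> Q be a chain map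
    back and h a homotopy, so that tau = 1 - be al - h d maps to cycles.  For a
    k-cycle z of Q one has h d z = 0 and al z = d y, hence z = tau z + be (d y).
    Both tau and be d take values in the cycles, and their sources are finitely
    generated. *)
Lemma comparison_fg (k : nat) (Q C : nat -> lmodType R)
    (dQ : forall i, {linear Q i.+1 -> Q i}) (dC : forall i, {linear C i.+1 -> C i})
    (al : forall i, {linear Q i -> C i}) (b0 : {linear C 0 -> Q 0}) :
  (forall i, (i < k)%N -> lifting (Q i.+1)) ->
  (forall i, (i <= k)%N -> lifting (C i.+1)) ->
  (forall y, exists x, dQ 0 x = y) ->
  (forall i x, dQ i (dQ i.+1 x) = 0) ->
  (forall i y, (i < k)%N -> dQ i y = 0 -> exists x, dQ i.+1 x = y) ->
  (forall i x, (i <= k)%N -> dC i (dC i.+1 x) = 0) ->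
  (forall i x, (i <= k)%N -> dC i (al i.+1 x) = al i (dQ i x)) ->
  cancel (al 0%N) b0 ->
  (forall z, dQ k z = 0 -> exists y, dC k.+1 y = al k.+1 z) ->
  finitely_generated (Q k.+1) -> finitely_generated (C k.+2) ->
  fg_ker (dQ k).
Proof.
move=> liftQ liftC dQ0S dQdQ exQ dCdC dal b0K bound [mQ [eQ genQ]] [mC [eC genC]].
have [be [be0 beP]] := staged_choice (T := fun i => {linear C i -> Q i})
  b0 (fun i (u : {linear C i -> Q i}) (v : {linear C i.+1 -> Q i.+1}) =>
     forall x, dQ i (v x) = u (dC i x))
  (fun i => \0).
have {}beP i : (i <= k)%N -> forall x, dQ i (be i.+1 x) = be i (dC i x).
  elim: i => [|i IH] ik; apply: beP.
    by apply: (liftC 0%N ik _ _ (dQ 0%N) (be 0%N \o dC 0%N)) => x; apply: dQ0S.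
  apply: (liftC _ ik _ _ (dQ i.+1) (be i.+1 \o dC i.+1)) => x; apply: exQ => //=.
  by rewrite IH ?(ltnW ik) // dCdC ?linear0 // ltnW.
have [h [h0 hP]] := staged_choice (T := fun i => {linear Q i -> Q i.+1}) \0
  (fun i (u : {linear Q i -> Q i.+1}) (v : {linear Q i.+1 -> Q i.+2}) =>
     forall x, dQ i.+1 (v x) = x - be i.+1 (al i.+1 x) - u (dQ i x))
  (fun i => \0).
pose tau i : {linear Q i.+1 -> Q i.+1} :=
  (idfun \- (be i.+1 \o al i.+1)) \- (h i \o dQ i).
have tauE i x : tau i x = x - be i.+1 (al i.+1 x) - h i (dQ i x) by [].
have tau0 i : (i <= k)%N -> forall x, dQ i (tau i x) = 0.
  elim: i => [|i IH] ik x.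
    by rewrite tauE !linearB /= beP // dal // h0 be0 b0K linear0 subrr subr0.
  rewrite tauE !linearB /= beP // dal //.
  have -> : dQ i.+1 (h i.+1 (dQ i.+1 x)) = tau i (dQ i.+1 x).
    apply: hP; apply: (liftQ _ ik _ _ (dQ i.+1) (tau i)) => y.
    by apply: exQ => //; apply: IH; apply: ltnW.
  by rewrite tauE dQdQ linear0 subr0 subrr.
clearbody tau; pose g : {linear C k.+2 -> Q k.+1} := be k.+1 \o dC k.+1.
have gE y : g y = be k.+1 (dC k.+1 y) by [].
clearbody g.
exists (mQ + mC)%N, (fun i => match fintype.split i with
  inl j => tau k (eQ j) | inr j => g (eC j) end).
split=> [i|z z0].
  case: fintype.split => j; first exact: tau0.
  by rewrite gE beP // dCdC // linear0.
have [y yz] := bound _ z0; have [a za] := genQ z; have [b yb] := genC y.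
exists (fun i => match fintype.split i with inl j => a j | inr j => b j end).
rewrite big_split_ord /=.
under eq_bigr => i _ do rewrite (unsplitK (inl i)).
under [X in _ + X]eq_bigr => i _ do rewrite (unsplitK (inr i)).
have -> : \sum_(i < mQ) a i *: tau k (eQ i) = tau k z.
  by rewrite za linear_span.
have -> : \sum_(i < mC) b i *: g (eC i) = g y.
  by rewrite yb linear_span.
by rewrite tauE z0 linear0 subr0 gE yz subrK.
Qed.

(** The given resolution serves as C in [comparison_fg]: as it is exact, al z
    bounds for every cycle z. *)
Lemma type_FP_can n A : type_FP n A ->
  forall i, (i <= n)%N -> fin_free (can_obj A i.+1).
Proof.
move=> [P fgP].
pose C i : lmodType R := if i is i'.+1 then P i' else A.
pose dC i : {linear C i.+1 -> C i} :=
  if i is i'.+1 then pr_diff P i' else pr_aug P.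
have dCdC i x : dC i (dC i.+1 x) = 0.
  by case: i x => [|i] x; [apply/pr_exact0 | apply/pr_exactS]; exists x.
have exC i (y : C i.+1) : dC i y = 0 -> exists x, dC i.+1 x = y.
  by case: i y => [|i] y; [move/pr_exact0 | move/pr_exactS].
have [al [al0 alP]] := staged_choice (T := fun i => {linear can_obj A i -> C i})
  idfun (fun i (u : {linear can_obj A i -> C i})
             (v : {linear can_obj A i.+1 -> C i.+1}) =>
     forall x, dC i (v x) = u (can_diff A i x)) (fun i => \0).
have {}alP i x : dC i (al i.+1 x) = al i (can_diff A i x).
  elim: i x => [|i IH]; apply: alP.
    apply: (@can_lifting A 0%N _ _ (dC 0%N) (al 0%N \o can_diff A 0%N)) => x.
    exact: pr_augS.
  apply: (@can_lifting A i.+1 _ _ (dC i.+1) (al i.+1 \o can_diff A i.+1)) => x.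
  apply: exC => /=; rewrite IH.
  by have /can_exact -> : exists y, can_diff A i.+1 y = can_diff A i.+1 x;
    [exists x | rewrite linear0].
elim=> [|k IH] kn.
  apply: can_fin_free0; have [m [e gen]] := fgP 0%N kn.
  exists m, (fun i => pr_aug P (e i)) => a; have [x <-] := pr_augS P a.
  by have [b ->] := gen x; exists b; rewrite linear_span.
apply: can_fin_freeS.
apply: (@comparison_fg k (can_obj A) C (can_diff A) dC al idfun).
- by move=> i _; apply: can_lifting.
- move=> i ik; apply: lifting_fg_projective; last exact: pr_proj.
  by apply: fgP; apply: leq_trans ik (ltnW kn).
- exact: can_diff0S.
- by move=> i x; apply/can_exact; exists x.
- by move=> i y _ /can_exact.
- by move=> i x _; apply: dCdC.
- by move=> i x _; apply: alP.
- by move=> x /=; rewrite al0.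
- by move=> z dz; apply: exC; rewrite alP dz linear0.
- by apply: fin_free_fg; apply: IH; apply: ltnW.
- exact: fgP.
Qed.

End Lifting.

(** * Modules over a monoid ring from additive actions *)

Section MonoidRingModules.
Variable M : monoidType.
Local Notation ZM := (monoid_ring M).

Definition gelt (k : M) : ZM := << 1 *g k >>.

Lemma gelt1 : gelt 1%g = 1. Proof. by []. Qed.

Lemma geltM k l : gelt (k * l)%g = gelt k * gelt l.
Proof. by rewrite [RHS]mr_mulUU mulr1. Qed.

Lemma malgU_gelt (a : int) (k : M) : << a *g k >> = gelt k *~ a.
Proof.
apply/malgP => l; rewrite raddfMz /= !mcoeffU.
by case: eqP => _; rewrite ?mulr0n ?mul0rz // !mulr1n intz.
Qed.

(** Monoid elements generate the monoid ring additively, so an additive map is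
    linear once it is equivariant. *)
Lemma gelt_linear (X Y : lmodType ZM) (f : X -> Y) :
  {morph f : x y / x + y} -> (forall k x, f (gelt k *: x) = gelt k *: f x) ->
  linear f.
Proof.
move=> fD fg p x y; rewrite fD; congr (_ + _).
have f0 : f 0 = 0 by apply: (addrI (f 0)); rewrite -fD !addr0.
have fN z : f (- z) = - f z by apply: (addrI (f z)); rewrite -fD !subrr.
have fM z m : f (z *+ m) = f z *+ m.
  by elim: m => [|m IH]; rewrite ?mulr0n // !mulrS fD IH.
elim/mr_ind: p => [|p q IHp IHq|a k]; first by rewrite !scale0r.
  by rewrite !scalerDl fD IHp IHq.
rewrite malgU_gelt -!scalerMzl.
by case: a => m; rewrite ?NegzE ?mulrNz ?fN -?pmulrn fM fg.
Qed.

End MonoidRingModules.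

Definition mk_linear (R : pzRingType) (X Y : lmodType R) (f : X -> Y)
  (fL : linear f) : {linear X -> Y} :=
  HB.pack f (GRing.isLinear.Build R X Y _ f fL).

Record maction (M : monoidType) (N : zmodType) := MAction {
  mact :> M -> N -> N;
  mactD : forall k, {morph mact k : x y / x + y};
  mact1 : forall x, mact 1%g x = x;
  mactM : forall k l x, mact (k * l)%g x = mact k (mact l x)
}.

Definition actmod (M : monoidType) (N : zmodType) (r : maction M N) : Type := N.

Section ActionModule.
Variables (M : monoidType) (N : zmodType) (r : maction M N).
Local Notation ZM := (monoid_ring M).
Local Notation V := (actmod r).

HB.instance Definition _ := GRing.Zmodule.copy V N.

Definition act_scale (p : ZM) (x : V) : V :=
  \sum_(k <- msupp p) (r k x : V) *~ p@_k.

Lemma act_scalew (d : {fset M}) (p : ZM) x : (msupp p `<=` d)%fset ->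
  act_scale p x = \sum_(k <- d) (r k x : V) *~ p@_k.
Proof.
move=> pd; apply: big_fset_incl => // k _ /mcoeff_outdom ->.
by rewrite mulr0z.
Qed.

Lemma act_scaleU (a : int) k x : act_scale << a *g k >> x = (r k x : V) *~ a.
Proof. by rewrite (act_scalew _ msuppU_le) big_seq_fset1 mcoeffUU. Qed.

Lemma act_scaleDl x : {morph act_scale^~ x : p q / p + q}.
Proof.
move=> p q; rewrite (act_scalew _ (msuppD_le p q)).
rewrite (act_scalew _ (fsubsetUl _ (msupp q))).
rewrite (act_scalew _ (fsubsetUr (msupp p) _)).
by rewrite -big_split /=; apply: eq_bigr => k _; rewrite mcoeffD mulrzDr.
Qed.

Lemma act_scaleDr : right_distributive act_scale +%R.
Proof.
move=> p x y; rewrite /act_scale -big_split /=; apply: eq_bigr => k _.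
by rewrite mactD mulrzDl.
Qed.

Lemma act_scale1 : left_id 1 act_scale.
Proof. by move=> x; rewrite [act_scale _ _]act_scaleU mact1. Qed.

Lemma act_scale0l x : act_scale 0 x = 0.
Proof. by apply: (addrI (act_scale 0 x)); rewrite -act_scaleDl !addr0. Qed.

Lemma act_scale0r p : act_scale p 0 = 0.
Proof. by apply: (addrI (act_scale p 0)); rewrite -act_scaleDr !addr0. Qed.

Lemma act_scaleMz p x a : act_scale p (x *~ a) = act_scale p x *~ a.
Proof.
have mn m : act_scale p (x *+ m) = act_scale p x *+ m.
  elim: m => [|m IH]; first by rewrite !mulr0n act_scale0r.
  by rewrite !mulrS act_scaleDr IH.
case: a => m; first by rewrite -!pmulrn mn.
rewrite NegzE !mulrNz -!pmulrn -mn; apply: (addrI (act_scale p (x *+ m.+1))).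
by rewrite -act_scaleDr !subrr act_scale0r.
Qed.

Lemma act_scaleA p q x : act_scale p (act_scale q x) = act_scale (p * q) x.
Proof.
elim/mr_ind: p => [|p p' IH IH'|a k].
- by rewrite mul0r !act_scale0l.
- by rewrite mulrDl !act_scaleDl IH IH'.
elim/mr_ind: q => [|q q' IH IH'|b l].
- by rewrite mulr0 !act_scale0l act_scale0r.
- by rewrite mulrDr !act_scaleDl act_scaleDr IH IH'.
rewrite [_ * _ in RHS]mr_mulUU [RHS]act_scaleU mactM.
by rewrite (act_scaleU b) act_scaleMz act_scaleU -mulrzA.
Qed.

HB.instance Definition _ := GRing.Zmodule_isLmodule.Build ZM V
  act_scaleA act_scale1 act_scaleDr act_scaleDl.

Lemma gelt_act k (x : V) : gelt k *: x = r k x.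
Proof. exact: act_scaleU. Qed.

End ActionModule.

(** * Cochains on words of commuting elements *)

Section Coboundary.
Variable L : eqType.

(** The alternating sum over the positions of a word of the values of g at the
    word with that position deleted.  The recursion on the first letter makes
    the cone operators and delta (delta g) = 0 immediate. *)
Fixpoint delta (D : zmodType) (g : seq L -> D) (w : seq L) : D :=
  if w is a :: v then g v - delta (fun u => g (a :: u)) v else 0.

Lemma eq_delta (D : zmodType) (g h : seq L -> D) w :
  (forall v, subseq v w -> (size v).+1 = size w -> g v = h v) ->
  delta g w = delta h w.
Proof.
elim: w g h => [|a w IH] g h gh //=; congr (_ - _).
  by apply: gh => //; apply: subseq_cons.
by apply: IH => v vw sv; apply: gh; rewrite /= ?eqxx ?sv.
Qed.

Lemma delta0 (D : zmodType) w : delta (fun=> 0 : D) w = 0.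
Proof. by elim: w => [|a w IH] //=; rewrite IH subrr. Qed.

Lemma deltaB (D : zmodType) (g h : seq L -> D) w :
  delta (fun v => g v - h v) w = delta g w - delta h w.
Proof.
elim: w g h => [|a w IH] g h /=; first by rewrite subrr.
by rewrite IH !opprD !opprK addrACA.
Qed.

Lemma deltaD (D : zmodType) (g h : seq L -> D) w :
  delta (fun v => g v + h v) w = delta g w + delta h w.
Proof.
elim: w g h => [|a w IH] g h /=; first by rewrite addr0.
by rewrite IH opprD addrACA.
Qed.

Lemma delta_delta (D : zmodType) (g : seq L -> D) w : delta (delta g) w = 0.
Proof.
elim: w g => [|a w IH] g //=.
by rewrite (deltaB g (delta (fun u => g (a :: u)))) IH subr0 subrr.
Qed.

Lemma delta_morph (D E : zmodType) (f : D -> E) (g : seq L -> D) w :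
  {morph f : x y / x - y} -> f 0 = 0 ->
  delta (fun v => f (g v)) w = f (delta g w).
Proof. by move=> fB f0; elim: w g => [|a w IH] g //=; rewrite IH fB. Qed.

Lemma delta_map (D : zmodType) (c : L -> L) (g : seq L -> D) w :
  delta (fun v => g (map c v)) w = delta g (map c w).
Proof. by elim: w g => [|a w IH] g //=; rewrite (IH (fun v => g (c a :: v))). Qed.

End Coboundary.

(** K k s says that the letter s has colour k.  A letter has at most one of the
    colours 0, ..., n, and y_k commutes with the letters of other colours. *)
Section ColouredWords.
Variables (T : groupType) (S : set T) (n : nat) (y : nat -> T)
  (K : nat -> set T).
Hypothesis Sy : forall k, (k <= n)%N -> S (y k).
Hypothesis yC : forall k s, (k <= n)%N -> S s -> ~ K k s -> commute (y k) s.
Hypothesis Ky : forall k, (k <= n)%N -> K k (y k).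
Hypothesis K1 : forall k l s, (k <= n)%N -> (l <= n)%N -> S s ->
  K k s -> K l s -> k = l.

Definition comm_word (w : seq T) : Prop :=
  (forall s, s \in w -> S s) /\
  (forall s t, s \in w -> t \in w -> commute s t).

Definition avoids k (w : seq T) : Prop := forall s, s \in w -> ~ K k s.

Lemma comm_word_sub v w : {subset v <= w} -> comm_word w -> comm_word v.
Proof.
by move=> vw [wS wC]; split=> [s /vw/wS | s t /vw sw /vw]; last exact: wC.
Qed.

Lemma comm_word_cons k w : (k <= n)%N ->
  comm_word w -> avoids k w -> comm_word (y k :: w).
Proof.
move=> kn [wS wC] wk; split=> [s|s t].
  by rewrite inE => /predU1P[->|/wS //]; apply: Sy.
have yw u : u \in w -> commute (y k) u.
  by move=> uw; apply: yC => //; [apply: wS | apply: wk].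
rewrite !inE => /predU1P[->|sw] /predU1P[->|tw] //; [exact: yw| |exact: wC].
exact/commute_sym/yw.
Qed.

(** Pigeonhole: n+1 colours cannot all occur in n letters. *)
Lemma avoids_some w : comm_word w -> (size w <= n)%N ->
  exists2 k, (k <= n)%N & avoids k w.
Proof.
move=> [wS _] wn; apply: contrapT => noavoid.
have hit (k : 'I_n.+1) : exists i : 'I_(size w), K k (nth 1%g w i).
  apply: contrapT => nk; apply: noavoid; exists (val k); first exact: leq_ord.
  move=> s sw ks; apply: nk; have iw := sw; rewrite -index_mem in iw.
  by exists (Ordinal iw); rewrite /= nth_index.
have [f fK] := choice hit.
have f_inj : injective f.
  move=> k l fkl; apply: val_inj.
  apply: (@K1 _ _ (nth 1%g w (f k))); rewrite ?leq_ord //.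
  - by apply: wS; apply: mem_nth.
  - exact: fK.
  - by rewrite fkl; apply: fK.
by have := leq_card f f_inj; rewrite !card_ord leqNgt ltnS wn.
Qed.

(** Let c_k g v be g (y_k :: v) if v avoids colour k, and 0 otherwise.  If g is a
    cocycle, then g - delta (c_k g) vanishes on the words that avoid colour k, by
    the cocycle identity at y_k :: w.  It still vanishes on the words that avoid
    an earlier colour l if g does: y_k does not have colour l.  After all n+1
    colours nothing is left on words of length at most n. *)
Lemma cochain_exact (D : zmodType) (g : seq T -> D) p : (p <= n)%N ->
  (forall w, comm_word w -> size w = p.+1 -> delta g w = 0) ->
  exists h, forall w, comm_word w -> size w = p -> g w = delta h w.
Proof.
move=> pn dg.
suff step m : (m <= n.+1)%N -> exists h, forall w, comm_word w -> size w = p ->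
    (exists2 l, (l < m)%N & avoids l w) -> g w = delta h w.
  have [h gh] := step _ (leqnn n.+1); exists h => w wC wp; apply: gh => //.
  by have [|k kn wk] := avoids_some wC; [rewrite wp | exists k].
elim: m => [|k IH] kn; first by exists (fun=> 0) => w _ _ [].
have [h gh] := IH (ltnW kn); pose g' v := g v - delta h v.
have g'0 w : comm_word w -> size w = p ->
    (exists2 l, (l < k)%N & avoids l w) -> g' w = 0.
  by move=> wC wp wl; rewrite /g' gh ?subrr.
pose c v := if pselect (avoids k v) is left _ then g' (y k :: v) else 0.
exists (fun v => h v + c v) => w wC wp [l lk wl].
apply/eqP; rewrite deltaD addrC -subr_eq; apply/eqP; rewrite -/(g' w).
have sub_avoids j v : subseq v w -> avoids j w -> avoids j v.
  by move=> /mem_subseq vw wj s /vw /wj.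
have [wk|wk] := pselect (avoids k w).
  (* The cocycle identity at y_k :: w expresses g' w through cone values. *)
  have : delta g' (y k :: w) = 0.
    rewrite (deltaB g (delta h)) delta_delta subr0; apply: dg; last by rewrite /= wp.
    exact: comm_word_cons.
  move/eqP; rewrite /= subr_eq0 => /eqP ->; apply: eq_delta => v vw _.
  by rewrite /c; case: pselect => // /(_ (sub_avoids _ _ vw wk)).
(* Now w has colour k, and it avoids an earlier colour l, as do its cone terms. *)
have {}lk : (l < k)%N.
  by move: lk; rewrite ltnS leq_eqVlt => /predU1P[lk|//]; rewrite lk in wl.
rewrite g'0 //; last by exists l.
rewrite -(delta0 D w); apply: eq_delta => v vw sv; rewrite /c.
case: pselect => // vk; rewrite g'0 //.
- apply: comm_word_cons => //; apply: comm_word_sub wC; exact: mem_subseq.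
- by rewrite /= sv.
- exists l => // s; rewrite inE => /predU1P[-> lyk|]; last exact: (sub_avoids _ _ vw wl).
  have ln : (l <= n)%N by apply: leq_trans (ltnW lk) kn.
  have := K1 ln kn (Sy kn) lyk (Ky kn); move=> lk'; by rewrite lk' ltnn in lk.
Qed.

End ColouredWords.

(** * Vanishing of Ext when translations act without fixed points *)

Section Cochains.
Variable T : groupType.
Local Notation ZT := (monoid_ring T).
Implicit Types (P X Y D : lmodType ZT) (w : seq T).

Lemma linear_gelt X Y (f : {linear X -> Y}) g x : f (gelt g *: x) = gelt g *: f x.
Proof. exact: linearZ. Qed.

Definition wconj (g : T) w : seq T := [seq conjg s g | s <- w].

Lemma wconj1 w : wconj 1%g w = w.
Proof. by rewrite /wconj (eq_map (@conjg1 T)) map_id. Qed.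

Lemma wconjM g h w : wconj (g * h)%g w = wconj h (wconj g w).
Proof. by rewrite /wconj -map_comp; apply: eq_map => s /=; rewrite conjgM. Qed.

(** Functions from words to X carry the diagonal action, T acting on the letters
    by conjugation.  So a linear map from P to cochain X amounts to an
    equivariant biadditive map, that is, to an equivariant map out of the tensor
    product of P with the chains on words. *)
Definition cochain_act X (g : T) (phi : seq T -> X) : seq T -> X :=
  fun w => gelt g *: phi (wconj g w).

Lemma cochain_actD X g : {morph @cochain_act X g : x y / x + y}.
Proof. by move=> x y; apply/funext => w; rewrite /cochain_act scalerDr. Qed.

Lemma cochain_act1 X phi : @cochain_act X 1%g phi = phi.
Proof. by apply/funext => w; rewrite /cochain_act wconj1 scale1r. Qed.

Lemma cochain_actM X g h phi :
  @cochain_act X (g * h)%g phi = cochain_act g (cochain_act h phi).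
Proof.
by apply/funext => w; rewrite /cochain_act wconjM geltM scalerA.
Qed.

Definition cochain_action X := MAction (@cochain_actD X) (@cochain_act1 X)
  (@cochain_actM X).

Definition cochain X : Type := actmod (cochain_action X).
HB.instance Definition _ X := GRing.Lmodule.on (cochain X).

Lemma cochainZ X g (phi : cochain X) w :
  (gelt g *: phi) w = gelt g *: phi (wconj g w).
Proof. by rewrite [gelt g *: phi]gelt_act. Qed.

Lemma cochainD X (phi psi : cochain X) w : (phi + psi) w = phi w + psi w.
Proof. by []. Qed.

Lemma cochain_linear P X (f : P -> cochain X) :
  (forall x y w, f (x + y) w = f x w + f y w) ->
  (forall g x w, f (gelt g *: x) w = gelt g *: f x (wconj g w)) -> linear f.
Proof.
move=> fD fZ; apply: gelt_linear => [x y|g x]; apply/funext => w.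
  exact: fD.
by rewrite fZ cochainZ.
Qed.

Definition cochain_map X Y (f : X -> Y) (phi : cochain X) : cochain Y :=
  fun w => f (phi w).

Lemma cochain_map_is_linear X Y (f : {linear X -> Y}) :
  linear (cochain_map f).
Proof.
apply: cochain_linear => [x y w|g x w]; rewrite /cochain_map.
  by rewrite cochainD linearD.
by rewrite cochainZ linearZ.
Qed.

HB.instance Definition _ X Y (f : {linear X -> Y}) :=
  GRing.isLinear.Build ZT (cochain X) (cochain Y) _ (cochain_map f)
    (cochain_map_is_linear f).

Definition cochain_delta X (phi : cochain X) : cochain X := delta phi.

Lemma cochain_delta_is_linear X : linear (@cochain_delta X).
Proof.
apply: cochain_linear => [x y w|g x w]; rewrite /cochain_delta.
  exact: deltaD.
rewrite -[in RHS]delta_map -(@delta_morph _ _ _ ( *:%R (gelt g))).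
- by apply: eq_delta => v _ _; rewrite cochainZ.
- by move=> u v; rewrite scalerBr.
- exact: scaler0.
Qed.

HB.instance Definition _ X :=
  GRing.isLinear.Build ZT (cochain X) (cochain X) _ (@cochain_delta X)
    (@cochain_delta_is_linear X).

Definition cochain_const X (x : X) : cochain X := fun=> x.

Lemma cochain_const_is_linear X : linear (@cochain_const X).
Proof. by apply: cochain_linear => // g x w. Qed.

HB.instance Definition _ X :=
  GRing.isLinear.Build ZT X (cochain X) _ (@cochain_const X)
    (@cochain_const_is_linear X).

Definition cochain_nil X (phi : cochain X) : X := phi [::].

Lemma cochain_nil_is_linear X : linear (@cochain_nil X).
Proof. by apply: gelt_linear => // g phi; rewrite /cochain_nil cochainZ. Qed.

HB.instance Definition _ X :=
  GRing.isLinear.Build ZT (cochain X) X _ (@cochain_nil X)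
    (@cochain_nil_is_linear X).

End Cochains.

Section Core.
Variables (T : groupType) (S : set T) (n : nat) (y : nat -> T)
  (K : nat -> set T).
Local Notation ZT := (monoid_ring T).
Hypothesis SJ : forall g s, S s -> S (conjg s g).
Hypothesis Sy : forall k, (k <= n)%N -> S (y k).
Hypothesis yC : forall k s, (k <= n)%N -> S s -> ~ K k s -> commute (y k) s.
Hypothesis Ky : forall k, (k <= n)%N -> K k (y k).
Hypothesis K1 : forall k l s, (k <= n)%N -> (l <= n)%N -> S s ->
  K k s -> K l s -> k = l.

Definition is_word p w := comm_word S w /\ size w = p.

Lemma is_word_sub p v w :
  is_word p.+1 w -> subseq v w -> (size v).+1 = size w -> is_word p v.
Proof.
move=> [wC wp] vw sv; split; last by move: sv; rewrite wp => -[].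
by apply: comm_word_sub wC; apply: mem_subseq.
Qed.

Lemma is_word_conj p g w : is_word p w -> is_word p (wconj g w).
Proof.
move=> [[wS wC] wp]; split; last by rewrite size_map.
split=> [s|s t] /mapP[s' s'w ->]; first exact/SJ/wS.
by move=> /mapP[t' t'w ->]; rewrite /commute -!conjMg wC.
Qed.

Lemma is_word_conjE p g w : is_word p (wconj g w) <-> is_word p w.
Proof.
split; last exact: is_word_conj.
by move=> /(is_word_conj g^-1); rewrite -wconjM mulgV wconj1.
Qed.

(** Forgets the values of a cochain outside the words of length p in commuting
    letters of S.  This turns statements about these words into equations
    between linear maps, to which lifting properties apply. *)
Definition restr p (X : lmodType ZT) (phi : cochain X) : cochain X :=
  fun w => if `[< is_word p w >] then phi w else 0.

Lemma restr_is_linear p (X : lmodType ZT) : linear (@restr p X).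
Proof.
apply: cochain_linear => [u v w|g u w]; rewrite /restr.
  by case: asboolP; rewrite ?addr0.
rewrite (asbool_equiv_eq (is_word_conjE p g w)).
by case: asboolP; rewrite ?scaler0 ?cochainZ.
Qed.

HB.instance Definition _ p X :=
  GRing.isLinear.Build ZT (cochain X) (cochain X) _ (@restr p X)
    (@restr_is_linear p X).

(** Exactness in the direction of the words is pointwise in x; the lifting
    property makes the choice linear in x. *)
Lemma horizontal (P X : lmodType ZT) (xi : {linear P -> cochain X}) p :
  lifting P -> (p <= n)%N ->
  (forall x w, is_word p.+1 w -> delta (xi x) w = 0) ->
  exists eta : {linear P -> cochain X},
    forall x w, is_word p w -> xi x w = delta (eta x) w.
Proof.
move=> liftP pn dxi.
have [x|eta etaE] :=
  liftP _ _ (@restr p X \o @cochain_delta T X) (@restr p X \o xi).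
  have [|h hP] := @cochain_exact _ S _ y K Sy yC Ky K1 _ (xi x) _ pn.
    by move=> w wC wp; apply: dxi.
  exists h; apply/funext => w; rewrite /= /restr.
  by case: asboolP => // -[wC wp]; rewrite hP.
exists eta => x w wp; have /(congr1 (fun f : cochain X => f w)) := etaE x.
by rewrite /= /restr; case: asboolP.
Qed.

Section Complex.
Variables (Q : nat -> lmodType ZT) (dQ : forall i, {linear Q i.+1 -> Q i}).
Hypothesis triv : forall g (z : Q 0), gelt g *: z = z.
Hypothesis liftQ : forall i, (i < n)%N -> lifting (Q i.+1).
Hypothesis dQdQ : forall i x, dQ i (dQ i.+1 x) = 0.
Hypothesis exQ : forall i x, (i < n)%N -> dQ i x = 0 ->
  exists z, dQ i.+1 z = x.

(** The right hand side of the homotopy equation d (H x) = x - s x - H (d x)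
    at a word with first letter s.  For the empty word s is 1. *)
Definition translation_defect (i : nat) (H : {linear Q i -> cochain (Q i.+1)})
    (x : Q i.+1) : cochain (Q i.+1) :=
  fun w => x - gelt (head 1%g w) *: x - H (dQ i x) w.

Lemma head_wconj g (w : seq T) : head 1%g (wconj g w) = conjg (head 1%g w) g.
Proof. by case: w => //=; rewrite conj1g. Qed.

Lemma gelt_conj (X : lmodType ZT) s g (x : X) :
  gelt s *: (gelt g *: x) = gelt g *: (gelt (conjg s g) *: x).
Proof. by rewrite !scalerA -!geltM conjgC. Qed.

Lemma translation_defect_is_linear i (H : {linear Q i -> cochain (Q i.+1)}) :
  linear (translation_defect H).
Proof.
apply: cochain_linear => [x z w|g x w]; rewrite /translation_defect.
  rewrite (linearD (dQ i)) (linearD H) cochainD scalerDr !opprD.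
  by rewrite (addrACA x z) (addrACA (x - gelt (head 1%g w) *: x)).
by rewrite head_wconj (linear_gelt (dQ i)) (linear_gelt H) cochainZ !scalerBr -gelt_conj.
Qed.

HB.instance Definition _ i H :=
  GRing.isLinear.Build ZT (Q i.+1) (cochain (Q i.+1)) _
    (@translation_defect i H) (@translation_defect_is_linear i H).

(** Translation by an element s of T is homotopic to the identity on a resolution
    of Z.  Carrying s along as the first letter of a word makes the homotopies
    for all s equivariant at once under conjugation. *)
Lemma translation_homotopy : exists H : forall i, {linear Q i -> cochain (Q i.+1)},
  (forall x, H 0%N x = 0) /\ forall i x w, (i <= n)%N ->
    dQ i (x - gelt (head 1%g w) *: x - H i (dQ i x) w) = 0.
Proof.
have [H [H0 HP]] := staged_choice (T := fun i => {linear Q i -> cochain (Q i.+1)})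
  \0 (fun i u v => forall x w, dQ i.+1 (v x w) = translation_defect u x w)
  (fun i => \0).
exists H; split=> [x|]; first by rewrite H0.
elim=> [|i IH] x w ik.
  by rewrite H0 subr0 linearB linear_gelt triv subrr.
have {}HP z v : dQ i.+1 (H i.+1 z v) = z - gelt (head 1%g v) *: z - H i (dQ i z) v.
  apply: (HP i); have [] := @liftQ _ ik _ _ (cochain_map (dQ i.+1)) (translation_defect (H i)).
    move=> z'; have ex v' : exists u, dQ i.+1 u = translation_defect (H i) z' v'.
      by apply: exQ => //; apply: IH; apply: ltnW.
    by have [h hP] := choice ex; exists h; apply/funext.
  move=> h hP; exists h => z' w'.
  exact: (congr1 (fun f : cochain _ => f w') (hP z')).
by rewrite 2!linearB linear_gelt HP dQdQ linear0 subr0 subrr.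
Qed.

Variable D : lmodType ZT.
Hypothesis bijD : forall s, S s -> forall d : D, exists! e, e - gelt s *: e = d.

(** The inverse of 1 - s on D, extended by 0 to s outside S; both parts are
    compatible with conjugation. *)
Lemma resolvent : exists inv : T -> D -> D,
  [/\ forall s e, S s -> inv s (e - gelt s *: e) = e,
      forall s d d', inv s (d + d') = inv s d + inv s d'
    & forall s g d, inv s (gelt g *: d) = gelt g *: inv (conjg s g) d].
Proof.
have ex s d : exists e : D, (S s -> e - gelt s *: e = d) /\ (~ S s -> e = 0).
  have [Ss|nS] := pselect (S s); last by exists 0.
  by have [e [eP _]] := bijD Ss d; exists e.
have [inv0 invP0] := choice (fun sd : T * D => ex sd.1 sd.2).
pose inv s d := inv0 (s, d).
have invS s d : S s -> inv s d - gelt s *: inv s d = d.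
  by case: (invP0 (s, d)).
have invN s d : ~ S s -> inv s d = 0 by case: (invP0 (s, d)).
have invU s d e : S s -> e - gelt s *: e = d -> inv s d = e.
  move=> Ss eP; have [e' [_ e'U]] := bijD Ss d.
  by rewrite -(e'U _ eP) (e'U _ (invS s d Ss)).
exists inv; split=> [s e Ss|s d d'|s g d]; first exact: invU.
  have [Ss|nS] := pselect (S s); last by rewrite !invN ?addr0.
  by apply: invU => //; rewrite scalerDr opprD addrACA !invS.
have [Ss|nS] := pselect (S s).
  apply: invU => //; rewrite gelt_conj -scalerBr invS //; exact: SJ.
have nSg : ~ S (conjg s g).
  by move=> /(@SJ g^-1%g); rewrite -conjgM mulgV conjg1.
by rewrite !invN ?scaler0.
Qed.

Definition kills_cycles i p (phi : {linear Q i.+1 -> cochain D}) :=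
  forall x w, is_word p w -> dQ i x = 0 -> phi x w = 0.

(** The first letter of a word of commuting letters fixes the word; this is why
    the words must commute. *)
Lemma word_head_fixed p w : is_word p.+1 w ->
  S (head 1%g w) /\ wconj (head 1%g w) w = w.
Proof.
case: w => [[]//|a w [[wS wC] _]] /=; split; first by apply: wS; apply: mem_head.
rewrite -[RHS]map_id.
apply: (proj1 (eq_in_map (fun s => conjg s a) id (a :: w))) => s sw.
by rewrite conjgE (wC s a) ?mem_head // mulKg.
Qed.

(** At a word w with first letter s, apply phi to the cycle x - s x - H (d x).
    As s w = w, this gives (1 - s) phi x = phi (H (d x)) at w, so psi is
    (1 - s)^-1 composed with phi and H. *)
Lemma vertical i p (phi : {linear Q i.+1 -> cochain D}) : (i <= n)%N ->
  kills_cycles p.+1 phi ->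
  exists psi : {linear Q i -> cochain D},
    (forall x w, is_word p.+1 w -> phi x w = psi (dQ i x) w) /\
    (i = 0%N -> forall z, psi z = 0).
Proof.
move=> ik phi0.
have [H [H0 HP]] := translation_homotopy.
have [inv [invK invD invJ]] := resolvent.
have inv0 s : inv s 0 = 0 by apply: (addrI (inv s 0)); rewrite -invD !addr0.
pose psi z : cochain D := fun w => inv (head 1%g w) (phi (H i z w) w).
have psiL : linear psi.
  apply: cochain_linear => [x z w|g x w]; rewrite /psi.
    by rewrite linearD cochainD linearD cochainD invD.
  by rewrite linear_gelt cochainZ linear_gelt cochainZ invJ -head_wconj.
exists (mk_linear psiL); split=> [x w wp|i0 z].
  have [Sa wa] := word_head_fixed wp; set a := head _ _ in Sa wa.
  have : phi (x - gelt a *: x - H i (dQ i x) w) w = 0 by apply: phi0 => //; apply: HP.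
  rewrite !(linearB phi) (linear_gelt phi).
  rewrite -[(_ - _) w]/(phi x w - (gelt a *: phi x) w - phi (H i (dQ i x) w) w).
  rewrite cochainZ wa => /eqP; rewrite subr_eq0 => /eqP phiE.
  by rewrite /= /psi -/a -phiE invK.
apply/funext => w; rewrite /= /psi.
have -> : H i z w = 0 by case: i i0 z {ik phi phi0 psi psiL} => // _ z; rewrite H0.
by rewrite linear0 inv0.
Qed.

(** The chase along a diagonal of the double complex of maps from Q_i to cochains
    on words of length p.  The map psi found in the vertical direction has a
    coboundary that is again a cocycle killing cycles, one step further along
    the diagonal; correct psi by a horizontal primitive.  In degree 0 the
    vertical step gives zero, and there is nothing to correct. *)
Lemma cocycle_descent i p (phi : {linear Q i.+1 -> cochain D}) :
  (i + p.+1 <= n.+1)%N -> kills_cycles p.+1 phi ->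
  (forall x w, is_word p.+2 w -> delta (phi x) w = 0) ->
  exists psi : {linear Q i -> cochain D},
    [/\ forall x w, is_word p.+1 w -> phi x w = psi (dQ i x) w,
        forall z w, is_word p.+2 w -> delta (psi z) w = 0
      & i = 0%N -> forall z, psi z = 0].
Proof.
elim: i p phi => [|i IH] p phi ip phi0 dphi.
  have [psi [phiE psi0]] := vertical (leq0n n) phi0.
  exists psi; split=> // z w _.
  by rewrite psi0 // (delta0 D).
have lt_in : (i < n)%N by rewrite addnS ltnS in ip; apply: leq_trans (leq_addr _ _) ip.
have [psi [phiE _]] := vertical lt_in phi0.
have kill : kills_cycles p.+2 (@cochain_delta T D \o psi).
  move=> _ w wp /(exQ lt_in)[x <-] /=; rewrite /cochain_delta -(dphi x w wp).
  by apply: eq_delta => v vw sv; rewrite phiE //; apply: is_word_sub vw sv.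
have [|z w _|xi [xiE dxi xi0]] := IH p.+1 _ _ kill.
- by rewrite addnS -addSn.
- exact: delta_delta.
case: i => [|i] in phi psi ip phi0 dphi lt_in phiE kill xi xiE dxi xi0 IH *.
  exists psi; split=> // z w wp.
  by rewrite (xiE z w wp : delta (psi z) w = _) xi0.
have [||eta etaE] := @horizontal _ _ xi p.+2 (@liftQ i (ltnW lt_in)).
- by move: ip; rewrite addSn ltnS; apply: leq_trans; rewrite addSn ltnS leq_addl.
- exact: dxi.
exists (psi \- (eta \o dQ i.+1)); split=> // [x w wp|z w wp].
  by rewrite /= dQdQ linear0 subr0; apply: phiE.
rewrite [LHS](deltaB (psi z) (eta (dQ i.+1 z))) -etaE //.
by rewrite (xiE z w wp : delta (psi z) w = _) subrr.
Qed.

(** A map f that kills cycles is pulled back to a cochain on words, constant in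
    the word.  Descent makes it a boundary there, and a cocycle on words of
    length 1 comes from the empty word. *)
Lemma Ext_vanishing i (f : {linear Q i.+2 -> D}) : (i < n)%N ->
  (forall x, dQ i.+1 x = 0 -> f x = 0) ->
  exists f' : {linear Q i.+1 -> D}, forall x, f x = f' (dQ i.+1 x).
Proof.
move=> lt_in f0.
have kill : kills_cycles 1 (@cochain_const T D \o f) by move=> x w _ /f0.
have [|x w|psi [psiE dpsi _]] := cocycle_descent _ kill.
- by rewrite addn1.
- by case: w => [[]//|a [[]//|b [|c w] []]] //= _ _; rewrite subr0 subrr.
have [|eta etaE] := @horizontal _ _ psi 1%N (@liftQ i lt_in) _ dpsi.
  exact: leq_ltn_trans lt_in.
exists (@cochain_nil T D \o eta) => x /=.
have wy : is_word 1 [:: y 0%N].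
  split=> //; split=> [s|s t]; rewrite !inE => /eqP->; first exact: Sy.
  by move=> /eqP->.
by rewrite (psiE x _ wy : f x = _) etaE //= subr0.
Qed.

End Complex.
End Core.

(** * Levels of group ring elements and germs of sequences *)

Lemma nat_above (R : realType) (x : R) : exists m : nat, x <= m%:R.
Proof.
exists (Num.bound `|x|); apply: le_trans (ler_norm _) _.
exact/ltW/archi_boundP/normr_ge0.
Qed.

Section GeometricSums.
Variables (A : pzRingType) (t : A).

Definition geom (m : nat) (p : A) : A := \sum_(k < m) p * t ^+ k.

Lemma geomD m : {morph geom m : p q / p + q}.
Proof.
by move=> p q; rewrite -big_split; apply: eq_bigr => k _; rewrite mulrDl.
Qed.

Lemma geom_telescope m p : geom m p - geom m p * t = p - p * t ^+ m.
Proof.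
elim: m => [|m IH]; first by rewrite /geom !big_ord0 mul0r expr0 mulr1 !subrr.
rewrite /geom big_ord_recr /= -/(geom m p) mulrDl opprD addrACA IH -mulrA -exprSr.
by rewrite addrA subrK.
Qed.

Lemma geom_mulr m p : geom m (p * t) = geom m p * t.
Proof.
rewrite mulr_suml; apply: eq_bigr => k _.
by rewrite -!mulrA -exprS -exprSr.
Qed.

Lemma geom_split k m p : (k <= m)%N ->
  geom m p - geom k p = \sum_(k <= i < m) p * t ^+ i.
Proof.
move=> le_km; rewrite /geom -!(big_mkord xpredT (fun k => p * t ^+ k)).
by rewrite (big_cat_nat (leq0n k) le_km) /= [LHS]addrC addKr.
Qed.

End GeometricSums.

Section Levels.
Variables (T : groupType) (R : realType) (chi : character T R).
Local Notation ZT := (monoid_ring T).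
Implicit Types (p q : ZT) (r : R).

Definition lev r p : Prop := forall k, k \in msupp p -> r <= chi k.

Lemma lev0 r : lev r 0. Proof. by move=> k; rewrite msupp0 in_fset0. Qed.

Lemma levD r p q : lev r p -> lev r q -> lev r (p + q).
Proof.
move=> rp rq k /(fsubsetP (msuppD_le _ _)); rewrite in_fsetU => /orP[/rp|/rq] //.
Qed.

Lemma levN r p : lev r p -> lev r (- p).
Proof. by move=> rp k; rewrite msuppN => /rp. Qed.

Lemma levB r p q : lev r p -> lev r q -> lev r (p - q).
Proof. by move=> rp /levN; apply: levD. Qed.

Lemma lev_sum r (I : Type) (s : seq I) (P : pred I) (F : I -> ZT) :
  (forall i, P i -> lev r (F i)) -> lev r (\sum_(i <- s | P i) F i).
Proof. by move=> rF; elim/big_ind: _ => //; [exact: lev0 | exact: levD]. Qed.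

Lemma le_lev r1 r2 p : r1 <= r2 -> lev r2 p -> lev r1 p.
Proof. by move=> le12 rp k /rp; apply: le_trans. Qed.

Lemma levU r (a : int) k : r <= chi k -> lev r << a *g k >>.
Proof. by move=> rk l /(fsubsetP msuppU_le); rewrite in_fset1 => /eqP->. Qed.

Lemma levM r1 r2 p q : lev r1 p -> lev r2 q -> lev (r1 + r2) (p * q).
Proof.
move=> rp rq; rewrite -[p * q]/(mr_mul p q) /mr_mul.
rewrite big_seq_cond; apply: lev_sum => k; rewrite andbT => kp.
rewrite big_seq_cond; apply: lev_sum => l; rewrite andbT => lq.
by apply: levU; rewrite charM lerD ?rp ?rq.
Qed.

Lemma char1 : chi 1%g = 0.
Proof. by apply: (addrI (chi 1%g)); rewrite -charM mulg1 addr0. Qed.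

Lemma charV k : chi k^-1%g = - chi k.
Proof. by apply: (addrI (chi k)); rewrite -charM mulgV char1 subrr. Qed.

Lemma char_conj k g : chi (conjg k g) = chi k.
Proof. by rewrite conjgE !charM charV addrC addrK. Qed.

Lemma charX k m : chi (k ^+ m)%g = m%:R * chi k.
Proof.
elim: m => [|m IH]; first by rewrite expg0 char1 mul0r.
by rewrite expgS charM IH -nat1r mulrDl mul1r.
Qed.

Lemma lev_gelt k : lev (chi k) (gelt k). Proof. exact: levU. Qed.

Lemma lev_ex p : exists m : nat, lev (- m%:R) p.
Proof.
have [m mP] : exists m : nat, forall k, k \in (msupp p : seq T) -> - chi k <= m%:R.
  elim: (msupp p : seq T) => [|k s [m IH]]; first by exists 0%N.
  have [j jk] : exists j : nat, - chi k <= j%:R.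
    exact: nat_above.
  exists (maxn j m) => l; rewrite inE => /predU1P[->|/IH lm].
    by apply: le_trans jk _; rewrite ler_nat leq_maxl.
  by apply: le_trans lm _; rewrite ler_nat leq_maxr.
by exists m => k /mP; rewrite lerNl.
Qed.

Definition bounded (a : nat -> ZT) : Prop :=
  exists c : nat, forall j, lev (- c%:R) (a j).

Variable B : zmodType.

(** Additive maps on sequences in the group ring that only depend on the class of
    a sequence modulo the bounded ones.  Such maps form a left module, by right
    multiplication of sequences, so that statements on homology with
    coefficients in germs of sequences become statements on Ext. *)
Definition germ_dual_pred (h : (nat -> ZT) -> B) : bool :=
  `[< {morph h : a b / a + b} /\ forall a, bounded a -> h a = 0 >].

Lemma germ_dual_closed : zmod_closed germ_dual_pred.
Proof.
split=> [|h h' /asboolP[hD h0] /asboolP[h'D h'0]]; apply/asboolP; split.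
- by move=> a b; rewrite addr0.
- by [].
- by move=> a b; rewrite -[LHS]/(h (a + b) - h' (a + b)) hD h'D opprD addrACA.
- by move=> a ba; rewrite -[LHS]/(h a - h' a) h0 // h'0 // subr0.
Qed.

Definition germ_dual : Type := {h : (nat -> ZT) -> B | germ_dual_pred h}.
HB.instance Definition _ := SubChoice.on germ_dual.
HB.instance Definition _ := GRing.SubChoice_isSubZmodule.Build
  ((nat -> ZT) -> B) germ_dual_pred germ_dual germ_dual_closed.

Lemma germ_dualP (h : germ_dual) :
  {morph val h : a b / a + b} /\ forall a, bounded a -> val h a = 0.
Proof. exact/asboolP/(valP h). Qed.

Lemma germ_dual0 (h : germ_dual) a : bounded a -> val h a = 0.
Proof. exact: (germ_dualP h).2. Qed.

Lemma germ_dualD (h : germ_dual) a b : val h (a + b) = val h a + val h b.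
Proof. exact: (germ_dualP h).1. Qed.

Lemma germ_dualB (h : germ_dual) a b : val h (a - b) = val h a - val h b.
Proof. by apply/eqP; rewrite -subr_eq opprK -germ_dualD subrK. Qed.

Lemma germ_dual_eq (h : germ_dual) a b : bounded (a - b) -> val h a = val h b.
Proof. by move=> /(germ_dual0 h); rewrite germ_dualB => /subr0_eq. Qed.

Definition mk_germ_dual (h : (nat -> ZT) -> B)
    (hD : {morph h : a b / a + b}) (h0 : forall a, bounded a -> h a = 0) : germ_dual :=
  exist germ_dual_pred h (asboolT (conj hD h0)).

Lemma bounded_lev r (a : nat -> ZT) : (forall j, lev r (a j)) -> bounded a.
Proof.
move=> ra; have [c rc] := nat_above (- r).
by exists c => j; apply: le_lev (ra j); rewrite lerNl.
Qed.

Lemma bounded_mulr a p : bounded a -> bounded (fun j => a j * p).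
Proof.
move=> [c ac]; have [m pm] := lev_ex p.
by apply: (@bounded_lev (- c%:R - m%:R)) => j; apply: levM.
Qed.

Lemma germ_dual_mulD p (h : germ_dual) :
  {morph (fun a : nat -> ZT => val h (fun j => a j * p)) : a b / a + b}.
Proof.
move=> a b; rewrite -germ_dualD; congr (val h _); apply/funext => j.
by rewrite -mulrDl.
Qed.

Definition germ_dual_mul p (h : germ_dual) : germ_dual :=
  mk_germ_dual (germ_dual_mulD p h) (fun a ba => germ_dual0 h (bounded_mulr p ba)).

Definition germ_dual_act (k : T) := germ_dual_mul (gelt k).

Lemma germ_dual_actD k : {morph germ_dual_act k : x y / x + y}.
Proof. by move=> x y; apply: val_inj; apply/funext => a. Qed.

Lemma germ_dual_act1 h : germ_dual_act 1%g h = h.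
Proof.
apply: val_inj; apply/funext => a /=; congr (val h _); apply/funext => j.
by rewrite mulr1.
Qed.

Lemma germ_dual_actM k l h :
  germ_dual_act (k * l)%g h = germ_dual_act k (germ_dual_act l h).
Proof.
apply: val_inj; apply/funext => a /=; congr (val h _); apply/funext => j.
by rewrite geltM mulrA.
Qed.

Definition germ_dual_action :=
  MAction germ_dual_actD germ_dual_act1 germ_dual_actM.

Definition germ_module : Type := actmod germ_dual_action.
HB.instance Definition _ := GRing.Lmodule.on germ_module.

Lemma germ_actE k (h : germ_module) a :
  val (gelt k *: h : germ_dual) a = val (h : germ_dual) (fun j => a j * gelt k).
Proof. by rewrite [gelt k *: h]gelt_act. Qed.

Lemma germ_scaleE p (h : germ_module) a :
  val (p *: h : germ_dual) a = val (h : germ_dual) (fun j => a j * p).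
Proof.
pose f (q : ZT^o) : germ_module := germ_dual_mul q h.
have fL : linear f.
  apply: gelt_linear => [q q'|k q]; apply: val_inj; apply/funext => b.
    rewrite -[RHS]/(val (h : germ_dual) (fun j => b j * q) +
                    val (h : germ_dual) (fun j => b j * q')) -germ_dualD.
    by congr (val (h : germ_dual) _); apply/funext => j; apply: mulrDr.
  rewrite germ_actE; congr (val (h : germ_dual) _); apply/funext => j.
  exact: mulrA.
have f1 : f 1 = h.
  apply: val_inj; apply/funext => b; congr (val (h : germ_dual) _).
  by apply/funext => j; rewrite mulr1.
have fp : f p = p *: h.
  pose g : {linear ZT^o -> germ_module} := mk_linear fL.
  have := linearZ_LR g p (1 : ZT^o).
  by rewrite -[g _]/(f (p * 1)) -[g 1]/(f 1) f1 mulr1.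
by rewrite -fp.
Qed.

Section Geometric.
Variable s : T.
Hypothesis s_gt0 : 0 < chi s.

Local Notation geom := (geom (gelt s)).

Lemma lev_geltX m : lev (m%:R * chi s) (gelt s ^+ m).
Proof.
elim: m => [|m IH]; first by rewrite mul0r expr0 -char1; apply: lev_gelt.
by rewrite exprS -nat1r mulrDl mul1r; apply: levM => //; apply: lev_gelt.
Qed.

Lemma lev_mul_geltX r p m : lev r p -> lev r (p * gelt s ^+ m).
Proof.
move=> rp; apply: (le_lev _ (levM rp (@lev_geltX m))).
by rewrite lerDl mulr_ge0 // ltW.
Qed.

Lemma geom_threshold_ex p : exists m, lev 0 (p * gelt s ^+ m).
Proof.
have [c pc] := lev_ex p; have [m mP] := nat_above (c%:R / chi s).
exists m; apply: (le_lev _ (levM pc (@lev_geltX m))).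
by rewrite addrC subr_ge0 -ler_pdivrMr.
Qed.

Definition threshold p := projT1 (cid (geom_threshold_ex p)).

Lemma lev_threshold p m : (threshold p <= m)%N -> lev 0 (p * gelt s ^+ m).
Proof.
rewrite /threshold; case: cid => k kP /= km.
by rewrite -(subnKC km) exprD mulrA; apply: lev_mul_geltX.
Qed.

Lemma lev_geom r m p : lev r p -> lev r (geom m p).
Proof. by move=> rp; apply: lev_sum => k _; apply: lev_mul_geltX. Qed.

Lemma lev_geomB m p : (threshold p <= m)%N ->
  lev 0 (geom m p - geom (threshold p) p).
Proof.
move=> le_m; rewrite geom_split //.
rewrite big_seq_cond; apply: lev_sum => k; rewrite mem_index_iota andbT.
by move=> /andP[lek _]; apply: lev_threshold.
Qed.

Lemma germ_dual_geom (h : germ_dual) (a : nat -> ZT) (m : nat -> nat) :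
  (forall j, threshold (a j) <= m j)%N ->
  val h (fun j => geom (m j) (a j)) =
  val h (fun j => geom (threshold (a j)) (a j)).
Proof.
move=> am; apply: germ_dual_eq; apply: (@bounded_lev 0) => j.
exact: lev_geomB.
Qed.

(** The inverse of 1 - s sends h to the map a |-> h (a + a s + a s^2 + ...),
    where the series for a_j is cut at a place that depends on j.  Cutting later
    changes the sequence by a bounded one, so all sufficiently late cuts give the
    same value; and a_j s^m is itself bounded for late cuts. *)
Lemma germ_module_bij (d : germ_module) : exists! e, e - gelt s *: e = d.
Proof.
pose inv (h : germ_dual) (a : nat -> ZT) : B :=
  val h (fun j => geom (threshold (a j)) (a j)).
have invE h a m : (forall j, threshold (a j) <= m j)%N ->
    inv h a = val h (fun j => geom (m j) (a j)).
  by move=> am; symmetry; apply: germ_dual_geom.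
have invD h : {morph inv h : a b / a + b}.
  move=> a b; pose m j := maxn (threshold ((a + b) j))
                            (maxn (threshold (a j)) (threshold (b j))).
  have mab j : (threshold ((a + b)%R j) <= m j)%N := leq_maxl _ _.
  have ma j : (threshold (a j) <= m j)%N := leq_trans (leq_maxl _ _) (leq_maxr _ _).
  have mb j : (threshold (b j) <= m j)%N := leq_trans (leq_maxr _ _) (leq_maxr _ _).
  rewrite (invE h _ _ mab) (invE h _ _ ma) (invE h _ _ mb) -germ_dualD.
  by congr (val h _); apply/funext => j; apply: geomD.
have inv0 h a : bounded a -> inv h a = 0.
  by move=> [c ac]; apply: germ_dual0; exists c => j; apply: lev_geom.
pose e0 : germ_module := mk_germ_dual (invD d) (inv0 d).
exists e0; split=> [|e ed].
  apply: val_inj; apply/funext => a; pose b j : ZT := a j * gelt s.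
  pose m j := maxn (threshold (a j)) (threshold (b j)).
  have ma j : (threshold (a j) <= m j)%N := leq_maxl _ _.
  have mb j : (threshold (b j) <= m j)%N := leq_maxr _ _.
  rewrite -[LHS]/(inv d a - val (gelt s *: e0 : germ_dual) a) germ_actE.
  rewrite -[val _ _]/(inv d b) (invE d _ _ ma) (invE d _ _ mb).
  rewrite -germ_dualB; apply: germ_dual_eq; apply: (@bounded_lev 0) => j.
  rewrite -[X in lev 0 X]/(geom (m j) (a j) - geom (m j) (b j) - a j).
  rewrite geom_mulr geom_telescope addrAC subrr add0r; apply: levN.
  by apply: lev_threshold; rewrite leq_maxl.
apply: val_inj; apply/funext => a; rewrite -[LHS]/(inv d a) /inv.
rewrite -{1}ed -[LHS]/(val (e : germ_dual) _ - val (gelt s *: e : germ_dual) _).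
rewrite germ_actE -germ_dualB; apply: germ_dual_eq.
apply: (@bounded_lev 0) => j; pose k := threshold (a j).
rewrite -[X in lev 0 X]/(geom k (a j) - geom k (a j) * gelt s - a j).
rewrite geom_telescope addrAC subrr add0r; apply: levN.
exact: lev_threshold.
Qed.

End Geometric.
End Levels.

(** * Liftings with uniformly bounded levels *)

Section BoundedLifting.
Variables (T : groupType) (R : realType) (chi : character T R).
Local Notation ZT := (monoid_ring T).
Local Notation lev := (lev chi).

Definition mlev r k l (A : 'M[ZT]_(k, l)) : Prop := forall i j, lev r (A i j).

Lemma mlevM r1 r2 k l m (A : 'M[ZT]_(k, l)) (B : 'M[ZT]_(l, m)) :
  mlev r1 A -> mlev r2 B -> mlev (r1 + r2) (A *m B).
Proof.
by move=> rA rB i j; rewrite mxE; apply: lev_sum => h _; apply: levM.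
Qed.

Lemma mlev_ex k l (A : 'M[ZT]_(k, l)) : exists m : nat, mlev (- m%:R) A.
Proof.
have [f fP] := choice (fun ij : 'I_k * 'I_l => lev_ex chi (A ij.1 ij.2)).
exists (\max_ij f ij)%N => i j; apply: le_lev (fP (i, j)).
by rewrite lerN2 ler_nat; apply: leq_bigmax.
Qed.

Variables (m m' : nat) (E : 'M[ZT]_(m, m')).

Definition bounded_image_pred : {pred nat -> 'rV[ZT]_m'} := fun u =>
  `[< exists (c : nat) (y : nat -> 'rV[ZT]_m),
        (forall j, mlev (- c%:R) (y j)) /\ forall j, u j = y j *m E >].

Lemma bounded_image_closed : zmod_closed bounded_image_pred.
Proof.
split=> [|u v /asboolP[c [y [yc uE]]] /asboolP[d [z [zd vE]]]]; apply/asboolP.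
  exists 0%N, (fun=> 0); split=> [j i k|j]; last by rewrite mul0mx.
  by rewrite mxE; apply: lev0.
exists (c + d)%N, (fun j => y j - z j); split=> [j i k|j]; last first.
  by rewrite mulmxBl -uE -vE.
rewrite !mxE natrD; apply: levB; [apply: le_lev (yc j i k)|apply: le_lev (zd j i k)];
  by rewrite lerN2 ?lerDl ?lerDr ler0n.
Qed.

HB.instance Definition _ := GRing.isZmodClosed.Build (nat -> 'rV[ZT]_m')
  bounded_image_pred bounded_image_closed.

Definition germ_quotient := Quotient.quot bounded_image_pred.
Local Notation B := germ_quotient.
Local Notation GM := (germ_module chi B).
Local Notation GD := (germ_dual chi B).

Definition germ_class (u : nat -> 'rV[ZT]_m') : B := \pi_(B)%qT u.

Lemma germ_classD : {morph germ_class : u v / u + v}.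
Proof. by move=> u v; rewrite /germ_class !piE. Qed.

Lemma germ_class_eq0 u : germ_class u = 0 <->
  exists (c : nat) (y : nat -> 'rV[ZT]_m),
    (forall j, mlev (- c%:R) (y j)) /\ forall j, u j = y j *m E.
Proof.
have E0 : (germ_class u == 0) = (u \in bounded_image_pred).
  by rewrite -[u in RHS]subr0 Quotient.idealrBE; congr (_ == _); rewrite -(raddf0 \pi_(B)%qT).
by split=> [/eqP|ex]; [rewrite E0 => /asboolP | apply/eqP; rewrite E0; apply/asboolP].
Qed.


(** The pairing of a map from a row module to D with a sequence of rows, that is,
    evaluation on the tensor product of germs of sequences with the rows. *)
Definition germ_pairing (k : nat) (f : 'rV[ZT]_k -> GM) (y : nat -> 'rV[ZT]_k) : B :=
  \sum_(c < k) val (f (delta_mx 0 c) : GD) (fun j => y j 0 c).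


Lemma germ_pairing_bounded k (f : 'rV[ZT]_k -> GM) (y : nat -> 'rV[ZT]_k) r :
  (forall j, mlev r (y j)) -> germ_pairing f y = 0.
Proof.
move=> yr; rewrite /germ_pairing big1 // => c _; apply: germ_dual0.
by apply: (@bounded_lev _ _ _ r) => j; apply: yr.
Qed.

Lemma germ_pairing_comp (f : 'rV[ZT]_m -> GM) (f' : {linear 'rV[ZT]_m' -> GM})
    (y : nat -> 'rV[ZT]_m) :
  (forall x, f x = f' (x *m E)) ->
  germ_pairing f y = germ_pairing f' (fun j => y j *m E).
Proof.
move=> ff'; rewrite /germ_pairing.
have val_sum (I : Type) (s : seq I) (F : I -> GM) a :
    val (\sum_(i <- s) F i : GD) a = \sum_(i <- s) val (F i : GD) a.
  elim: s => [|i s IH]; first by rewrite !big_nil.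
  by rewrite !big_cons -IH.
have sum_val (h : GM) k (F : 'I_k -> nat -> ZT) :
    \sum_i val (h : GD) (F i) = val (h : GD) (fun j => \sum_i F i j).
  have -> : (fun j => \sum_i F i j) = \sum_i F i.
    by apply/funext => j; rewrite fct_sumE.
  elim/big_ind2: _ => // [|u a v b -> ->]; last by rewrite germ_dualD.
  symmetry; apply: germ_dual0; exists 0%N => j; exact: lev0.
have expand b : val (f (delta_mx 0 b) : GD) (fun j => y j 0 b) =
    \sum_c val (f' (delta_mx 0 c) : GD) (fun j => y j 0 b * E b c).
  rewrite ff' -rowE (lincomb_row f') /lincomb val_sum; apply: eq_bigr => c _.
  by rewrite germ_scaleE mxE.
under eq_bigr => b _ do rewrite expand.
rewrite exchange_big; apply: eq_bigr => c _; rewrite sum_val.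
by congr (val _ _); apply/funext => j; rewrite mxE.
Qed.

(** Sends x to the map that takes a sequence a in the group ring to the class of
    the sequence a_j x E.  It kills the kernel of E, so it factors through E when
    Ext vanishes. *)
Definition germ_tautological (x : 'rV[ZT]_m) : GM.
Proof.
apply: (@mk_germ_dual _ _ _ B (fun a => germ_class (fun j => a j *: (x *m E)))).
  move=> a b; rewrite -germ_classD; congr germ_class; apply/funext => j.
  by rewrite -[LHS]/((a j + b j) *: _) scalerDl.
move=> a [c ac]; apply/germ_class_eq0; have [d xd] := mlev_ex x.
exists (c + d)%N, (fun j => a j *: x); split=> [j i k|j]; last by rewrite scalemxAl.
by rewrite mxE natrD opprD; apply: levM.
Defined.

Lemma germ_tautological_linear : linear germ_tautological.
Proof.
apply: gelt_linear => [x z|k x]; apply: val_inj; apply/funext => a.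
  rewrite -[RHS]germ_classD; congr germ_class; apply/funext => j.
  by rewrite mulmxDl scalerDr.
have act := germ_actE k (germ_tautological x : GM) a.
transitivity (germ_class (fun j => (a j * gelt k) *: (x *m E))); last exact: esym act.
rewrite -[LHS]/(germ_class (fun j => a j *: ((gelt k *: x) *m E))).
apply: (congr1 germ_class).
apply/funext => j.
rewrite -(scalemxAl (gelt k) x E).
exact: scalerA.
Qed.

Lemma germ_pairing_tautological y :
  germ_pairing germ_tautological y = germ_class (fun j => y j *m E).
Proof.
rewrite /germ_pairing -(big_morph _ germ_classD (_ : germ_class 0 = 0)); last first.
  by apply/germ_class_eq0; exists 0%N, (fun=> 0); split=> [j i k|j];
    rewrite ?mul0mx // mxE; apply: lev0.
congr germ_class; apply/funext => j; rewrite fct_sumE.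
rewrite [in RHS](row_sum_delta (y j)) mulmx_suml; apply: eq_bigr => c _.
by rewrite scalemxAl.
Qed.

(** Suppose that no bound works, and let z_j = y_j E be a sequence whose j-th term
    has no lifting of level -j.  Pairing the tautological map with y gives the
    class of z.  As this map factors through E, the pairing is also the value of
    the factor at z itself, and this vanishes because z has level r.  So z has
    liftings of a common level, which contradicts the choice of z. *)
Lemma uniform_lifting (S : set T) :
  (forall s, S s -> 0 < chi s) ->
  (forall (D : lmodType ZT) (f : {linear 'rV[ZT]_m -> D}),
    (forall s, S s -> forall d : D, exists! e, e - gelt s *: e = d) ->
    (forall x, x *m E = 0 -> f x = 0) ->
    exists f' : {linear 'rV[ZT]_m' -> D}, forall x, f x = f' (x *m E)) ->
  forall r, exists c : nat, forall z : 'rV[ZT]_m', mlev r z ->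
    (exists y, z = y *m E) -> exists2 y : 'rV[ZT]_m, mlev (- c%:R) y & z = y *m E.
Proof.
move=> S_gt0 ext r; apply: contrapT => nbd.
have bad (c : nat) : exists zy : 'rV[ZT]_m' * 'rV[ZT]_m,
    [/\ mlev r zy.1, zy.1 = zy.2 *m E
      & forall y, mlev (- c%:R) y -> zy.1 <> y *m E].
  apply: contrapT => nz; apply: nbd; exists c => z zr [y zy].
  apply: contrapT => ny; apply: nz; exists (z, y); split=> // y' y'c zy'.
  by apply: ny; exists y'.
have [zy zyP] := choice bad.
have [||f' f'P] := ext GM (mk_linear germ_tautological_linear).
- by move=> s /S_gt0 s0 d; apply: germ_module_bij.
- move=> x xE; apply: val_inj; apply/funext => a.
  apply/germ_class_eq0; exists 0%N, (fun=> 0); split=> [j i k|j].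
    by rewrite mxE; apply: lev0.
  by rewrite xE scaler0 mul0mx.
have := germ_pairing_tautological (fun j => (zy j).2).
rewrite (germ_pairing_comp _ f'P) (@germ_pairing_bounded _ _ _ r); last first.
  by move=> j; have [+ <-] := zyP j.
move=> /esym/germ_class_eq0[c [y [yc yE]]].
have [_ zE] := zyP c; apply; first exact: yc.
by rewrite zE yE.
Qed.

End BoundedLifting.

(** * Resolutions by matrices *)

Section MatrixResolution.
Variable R : nzRingType.
Implicit Type A : lmodType R.

Definition mx_obj A (m : nat -> nat) (i : nat) : lmodType R :=
  if i is j.+1 then 'rV[R]_(m j) else A.

Definition mx_diff A (m : nat -> nat) (eps : {linear 'rV[R]_(m 0%N) -> A})
    (E : forall i, 'M[R]_(m i.+1, m i)) (i : nat) :
    {linear mx_obj A m i.+1 -> mx_obj A m i} :=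
  if i is j.+1 return {linear mx_obj A m i.+1 -> mx_obj A m i}
  then mulmxr (E j) else eps.

Record coordinates (X : lmodType R) := Coordinates {
  co_dim : nat;
  co_to : {linear X -> 'rV[R]_co_dim};
  co_from : {linear 'rV[R]_co_dim -> X}
}.

(** In degrees above n the matrices are 0, so that the composites of consecutive
    maps vanish in all degrees. *)
Lemma matrix_complex n (Q : nat -> lmodType R)
    (dQ : forall i, {linear Q i.+1 -> Q i}) :
  (forall i, (i <= n)%N -> fin_free (Q i.+1)) ->
  (forall a, exists x, dQ 0%N x = a) ->
  (forall i x, dQ i (dQ i.+1 x) = 0) ->
  (forall i x, dQ i x = 0 -> exists y, dQ i.+1 y = x) ->
  exists (m : nat -> nat) (eps : {linear 'rV[R]_(m 0%N) -> Q 0%N})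
    (E : forall i, 'M[R]_(m i.+1, m i)),
    let d := mx_diff eps E in
    [/\ forall a, exists x, d 0%N x = a,
        forall i x, d i (d i.+1 x) = 0
      & forall i x, (i < n)%N -> d i x = 0 -> exists y, d i.+1 y = x].
Proof.
move=> fin dQ0S dQdQ exQ.
have coord i : {c : coordinates (Q i.+1) |
    if (i <= n)%N then cancel (co_to c) (co_from c) /\ cancel (co_from c) (co_to c)
    else (forall x, co_to c x = 0) /\ (forall x, co_from c x = 0)}.
  apply/cid; case: leqP => [/fin[m [u [v uvK]]]|_]; first by exists (Coordinates u v).
  by exists (@Coordinates _ 0%N \0 \0).
pose c i := sval (coord i).
have cK i : (i <= n)%N -> cancel (co_to (c i)) (co_from (c i)) /\
    cancel (co_from (c i)) (co_to (c i)).
  by rewrite /c; case: (coord i) => c' /= + le_in; rewrite le_in.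
have c0 i : ~~ (i <= n)%N ->
    (forall x, co_to (c i) x = 0) /\ (forall x, co_from (c i) x = 0).
  by rewrite /c; case: (coord i) => c' /= + /negPf nle; rewrite nle.
pose m i := co_dim (c i); pose F := mx_obj (Q 0%N) m.
pose u i : {linear Q i -> F i} := if i is j.+1 then co_to (c j) else idfun.
pose v i : {linear F i -> Q i} := if i is j.+1 then co_from (c j) else idfun.
have uK i : (i <= n.+1)%N -> cancel (u i) (v i).
  by case: i => [|i] //= /cK[].
have vK i : (i <= n.+1)%N -> cancel (v i) (u i).
  by case: i => [|i] //= /cK[].
have u0 i x : ~~ (i <= n.+1)%N -> u i x = 0.
  by case: i x => [|i] x // /c0[].
have v0 i x : ~~ (i <= n.+1)%N -> v i x = 0.
  by case: i x => [|i] x // /c0[].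
pose dF i : {linear F i.+1 -> F i} := u i \o (dQ i \o v i.+1).
exists m, (dF 0%N), (fun i => lin1_mx (dF i.+1)) => d.
have dE i x : d i x = dF i x by case: i x => [|i] x //; apply: mul_rV_lin1.
split=> [a|i x|i x lt_in].
- have [x xa] := dQ0S a; exists (u 1%N x).
  by rewrite dE -[LHS]/(dQ 0%N (v 1%N (u 1%N x))) uK.
- rewrite !dE; have [le_in|gt_in] := boolP (i.+1 <= n.+1)%N.
    by rewrite -[dF i _]/(u i (dQ i (v i.+1 (u i.+1 (dQ i.+1 (v i.+2 x)))))) uK // dQdQ linear0.
  by rewrite -[dF i.+1 x]/(u i.+1 (dQ i.+1 (v i.+2 x))) u0 ?linear0.
rewrite dE => dx0.
have [y yE] : exists y, dQ i.+1 y = v i.+1 x.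
  apply: exQ.
  rewrite -[LHS]uK; last by apply: leq_trans (ltnW lt_in) (leqnSn n).
  by rewrite -[u i _]/(dF i x) dx0 linear0.
exists (u i.+2 y); rewrite dE -[LHS]/(u i.+1 (dQ i.+1 (v i.+2 (u i.+2 y)))).
by rewrite uK // yE vK //; apply: ltnW.
Qed.

End MatrixResolution.

(** * Descent to the monoid ring of the nonnegative half *)

Section Restriction.
Variables (T : groupType) (R : realType) (chi : character T R).
Local Notation ZT := (monoid_ring T).
Local Notation M := (char_monoid chi).
Local Notation ZM := (monoid_ring M).
Local Notation lev := (lev chi).
Local Notation mlev := (mlev chi).

Section Functor.
Variable X : lmodType ZT.

Definition res_act (k : M) (x : X) : X := gelt (val k) *: x.

Lemma res_actD k : {morph res_act k : x y / x + y}.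
Proof. by move=> x y; apply: scalerDr. Qed.

Lemma res_act1 x : res_act 1%g x = x.
Proof. exact: scale1r. Qed.

Lemma res_actM k l x : res_act (k * l)%g x = res_act k (res_act l x).
Proof. by rewrite /res_act scalerA -geltM. Qed.

Definition res_action := MAction res_actD res_act1 res_actM.

(** Restriction of scalars along the inclusion of M in T. *)
Definition resmod : Type := actmod res_action.
HB.instance Definition _ := GRing.Lmodule.on resmod.

Lemma res_geltE (k : M) (x : resmod) : gelt k *: x = gelt (val k) *: (x : X).
Proof. exact: gelt_act. Qed.

End Functor.

Definition resmap (X Y : lmodType ZT) (f : X -> Y) : resmod X -> resmod Y := f.

Lemma resmap_is_linear (X Y : lmodType ZT) (f : {linear X -> Y}) : linear (resmap f).
Proof.
apply: gelt_linear => [x y|k x]; first exact: linearD.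
by rewrite !res_geltE; apply: linear_gelt.
Qed.

HB.instance Definition _ (X Y : lmodType ZT) (f : {linear X -> Y}) :=
  GRing.isLinear.Build ZM (resmod X) (resmod Y) _ (resmap f)
    (resmap_is_linear f).

(** The inclusion of Z[M] in Z[T]. *)
Definition emb (p : ZM) : ZT := p *: (1 : resmod ZT^o).

Lemma embD : {morph emb : p q / p + q}.
Proof. by move=> p q; exact: (scalerDl (1 : resmod ZT^o) p q). Qed.

Lemma emb_gelt k : emb (gelt k) = gelt (val k).
Proof. by rewrite /emb res_geltE; exact: (mulr1 (gelt (val k))). Qed.

Lemma emb0 : emb 0 = 0. Proof. exact: (scale0r (1 : resmod ZT^o)). Qed.

Lemma embU (a : int) k : emb << a *g k >> = << a *g val k >>.
Proof. by rewrite !malgU_gelt /emb -scalerMzl res_geltE [_ *: _]mulr1. Qed.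

Lemma emb_coef p k : (emb p)@_(val k) = p@_k.
Proof.
elim/mr_ind: p => [|p q IHp IHq|a l]; first by rewrite emb0 !mcoeff0.
  by rewrite embD !mcoeffD IHp IHq.
by rewrite embU !mcoeffU (inj_eq val_inj).
Qed.

Lemma emb_inj : injective emb.
Proof. by move=> p q pq; apply/malgP => k; rewrite -!emb_coef pq. Qed.

Lemma lev_emb p : lev 0 (emb p).
Proof.
elim/mr_ind: p => [|p q IHp IHq|a k]; first by rewrite emb0; apply: lev0.
  by rewrite embD; apply: levD.
by rewrite embU; apply: levU; apply: (valP k).
Qed.

Lemma lev_emb_ex q : lev 0 q -> exists p, emb p = q.
Proof.
move=> q0; rewrite (monalgE q) big_seq.
elim/big_ind: _ => [|_ _ [p <-] [p' <-]|k /q0 k0]; first by exists 0; apply: emb0.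
  by exists (p + p'); apply: embD.
by exists << q@_k *g (exist _ k k0 : M) >>; apply: embU.
Qed.

Lemma embZ k p : emb (gelt k * p) = gelt (val k) * emb p.
Proof. by rewrite /emb -scalerA res_geltE. Qed.

(** Right multiplication by g^-1 identifies the rows over Z[M] with the rows over
    Z[T] of level at least - chi g. *)
Section ShiftedRows.
Variables (g : T) (m : nat).

Definition shift_row (a : 'rV[ZM]_m) : resmod 'rV[ZT]_m :=
  \row_c (emb (a 0 c) * gelt g^-1%g).

Lemma shift_row_is_linear : linear shift_row.
Proof.
apply: gelt_linear => [a b|k a].
  by apply/rowP => c; rewrite !mxE embD mulrDl.
by rewrite res_geltE; apply/rowP => c; rewrite !mxE embZ mulrA.
Qed.

HB.instance Definition _ :=
  GRing.isLinear.Build ZM 'rV[ZM]_m (resmod 'rV[ZT]_m) _ shift_row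
    shift_row_is_linear.

Lemma gelt_mulVK (h : T) (p : ZT) : p * gelt h^-1%g * gelt h = p.
Proof. by rewrite -mulrA -geltM mulVg gelt1 mulr1. Qed.

Lemma gelt_mulKV (h : T) (p : ZT) : p * gelt h * gelt h^-1%g = p.
Proof. by rewrite -mulrA -geltM mulgV gelt1 mulr1. Qed.

Lemma shift_row_inj : injective shift_row.
Proof.
move=> a b /rowP ab; apply/rowP => c; apply: emb_inj.
by have := ab c; rewrite !mxE => /(congr1 ( *%R^~ (gelt g))); rewrite !gelt_mulVK.
Qed.

Lemma mlev_shift_row a : mlev (- chi g) (shift_row a : 'rV[ZT]_m).
Proof.
move=> i c; rewrite mxE -[- _]add0r; apply: levM; first exact: lev_emb.
by rewrite -charV; apply: lev_gelt.
Qed.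

Lemma shift_row_ex (v : 'rV[ZT]_m) : mlev (- chi g) v ->
  exists a, shift_row a = v.
Proof.
move=> vg.
have ex c : exists p, emb p = v 0 c * gelt g.
  apply: lev_emb_ex; rewrite -[0](addNr (chi g)).
  by apply: levM; [apply: vg | apply: lev_gelt].
have [a aP] := choice ex; exists (\row_c a c).
by apply/rowP => c; rewrite !mxE aP gelt_mulKV.
Qed.

End ShiftedRows.

Lemma res_row_scaleE k (p : ZM) (v : resmod 'rV[ZT]_k) :
  p *: v = emb p *: (v : 'rV[ZT]_k).
Proof.
pose f (q : ZM^o) : resmod 'rV[ZT]_k := emb q *: (v : 'rV[ZT]_k).
have fL : linear f.
  apply: gelt_linear => [q q'|l q]; first by rewrite /f embD scalerDl.
  by rewrite res_geltE /f [X in emb X]/(gelt l * q) embZ scalerA.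
pose g : {linear ZM^o -> resmod 'rV[ZT]_k} := mk_linear fL.
have := linearZ_LR g p (1 : ZM^o).
rewrite -[g _]/(f (p * 1)) -[g 1]/(f 1) mulr1 => fp.
have f1 : f 1 = v by rewrite /f -[X in emb X]/(gelt 1%g) emb_gelt scale1r.
by rewrite f1 in fp.
Qed.

Lemma mlev_res_scale (r : R) k (p : ZM) (v : 'rV[ZT]_k) :
  mlev r v -> mlev r (p *: (v : resmod 'rV[ZT]_k) : 'rV[ZT]_k).
Proof.
move=> vr; refine (eq_ind_r (fun u : 'rV[ZT]_k => mlev r u) _ (res_row_scaleE p v)).
by move=> i j; rewrite mxE -[r]add0r; apply: levM; [apply: lev_emb | apply: vr].
Qed.

Lemma mlev_of_fg (P : lmodType ZM) k (f : {linear P -> resmod 'rV[ZT]_k}) :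
  finitely_generated P ->
  exists c : nat, forall x, mlev (- c%:R) (f x : 'rV[ZT]_k).
Proof.
move=> [m [e gen]].
have [l lP] := choice (fun i => mlev_ex chi (f (e i) : 'rV[ZT]_k)).
have lc i : (l i <= \max_i l i)%N by apply: leq_bigmax.
move: (\max_i l i)%N lc => c lc; exists c => x; have [a ->] := gen x.
rewrite linear_span; elim/big_ind: _ => [i j|u v ul vl i j|i _].
- by rewrite -[X in lev _ X]/((0 : 'rV[ZT]_k) i j) mxE; apply: lev0.
- rewrite -[X in lev _ X]/(((u : 'rV[ZT]_k) + (v : 'rV[ZT]_k)) i j) mxE.
  by apply: levD; [apply: ul | apply: vl].
apply: mlev_res_scale => i' j; apply: le_lev (lP i i' j).
by rewrite lerN2 ler_nat.
Qed.

End Restriction.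

Section Assembly.
Variables (T : groupType) (R : realType) (chi : character T R) (t : T).
Hypothesis t_gt0 : 0 < chi t.
Local Notation ZT := (monoid_ring T).
Local Notation M := (char_monoid chi).
Local Notation ZM := (monoid_ring M).
Local Notation mlev := (mlev chi).
Variables (n : nat) (m : nat -> nat)
  (eps : {linear 'rV[ZT]_(m 0%N) -> trivial_module T})
  (E : forall i, 'M[ZT]_(m i.+1, m i)).
Local Notation F := (mx_obj (trivial_module T : lmodType ZT) m).
Local Notation d := (mx_diff eps E).
Hypothesis d0S : forall a, exists x, d 0%N x = a.
Hypothesis dd : forall i x, d i (d i.+1 x) = 0.
Hypothesis ex_d : forall i x, (i < n)%N -> d i x = 0 -> exists y, d i.+1 y = x.
Hypothesis uniform : forall i, (i < n)%N -> forall r, exists c : nat,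
  forall z : 'rV[ZT]_(m i), mlev r z -> (exists y, z = y *m E i) ->
  exists2 y : 'rV[ZT]_(m i.+1), mlev (- c%:R) y & z = y *m E i.

Local Notation Q := (can_obj (trivial_module M : lmodType ZM)).
Local Notation dQ := (can_diff (trivial_module M : lmodType ZM)).

Definition triv_res (z : trivial_module M) : resmod chi (trivial_module T : lmodType ZT) := z.

Lemma triv_res_linear : linear triv_res.
Proof.
apply: gelt_linear => // k z.
by rewrite res_geltE [RHS]triv_scaleU [gelt k *: z]triv_scaleU.
Qed.

Lemma fin_free_row k : fin_free 'rV[ZM]_k.
Proof. by exists k, idfun, idfun. Qed.

Lemma res_chain_map : exists a : forall i, {linear Q i -> resmod chi (F i)},
  a 0%N = mk_linear triv_res_linear /\
  forall i x, (i <= n)%N -> d i (a i.+1 x) = a i (dQ i x).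
Proof.
have [a [a0 aP]] := staged_choice (T := fun i => {linear Q i -> resmod chi (F i)})
  (mk_linear triv_res_linear)
  (fun i (u : {linear Q i -> resmod chi (F i)})
     (v : {linear Q i.+1 -> resmod chi (F i.+1)}) =>
     forall x, d i (v x) = u (dQ i x)) (fun i => \0).
exists a; split=> // i x le_in; elim: i le_in x => [|i IH] le_in; apply: aP.
  have [x|h hP] :=
    @can_lifting _ _ 0%N _ _ (@resmap _ _ chi _ _ (d 0%N)) (a 0%N \o dQ 0%N).
    exact: d0S.
  by exists h => x; apply: hP.
have [x|h hP] :=
  @can_lifting _ _ i.+1 _ _ (@resmap _ _ chi _ _ (d i.+1)) (a i.+1 \o dQ i.+1).
  apply: ex_d => //; rewrite -[X in d i X]/(a i.+1 (dQ i.+1 x)) IH ?(ltnW le_in) //.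
  by have /can_exact -> : exists y, dQ i.+1 y = dQ i.+1 x; [exists x | apply: linear0].
by exists h => x; apply: hP.
Qed.

(** Induction on the degree.  In [comparison_fg] the complex C consists of the
    submodules of F_i of level at least - chi (g i), given by shifted rows.  All
    the bounds that occur are below N chi t for one N, and g i is a power of t
    that loses N factors in each degree: this absorbs the amount by which the
    differential of F lowers levels. *)
Theorem type_FP_char_monoid :
  type_FP n (trivial_module M : lmodType ZM).
Proof.
apply: can_type_FP => k; elim/ltn_ind: k => -[_ _|k IH lt_kn].
  apply: can_fin_free0; exists 1%N, (fun=> 1 : int) => z.
  exists (fun=> << (z : int) *g 1%g >>).
  rewrite big_ord1 -[RHS]/(augmentation _ * (1 : int)) augmentationU.
  by rewrite mulr1.
apply: can_fin_freeS.
have [a [a0 da]] := res_chain_map.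
have level i : exists l : nat, (i <= k)%N ->
    (forall x, mlev (- l%:R) (a i.+1 x : 'rV[ZT]_(m i))) /\ mlev (- l%:R) (E i).
  have [le_ik|nle] := boolP (i <= k)%N; last by exists 0%N.
  have fgQ : finitely_generated (Q i.+1).
    by apply: fin_free_fg; apply: IH => //; apply: leq_trans (ltnW lt_kn).
  have [l1 l1P] := mlev_of_fg (a i.+1) fgQ.
  have [l2 l2P] := mlev_ex chi (E i).
  exists (l1 + l2)%N => _; rewrite natrD; split=> [x|] j h.
    by apply: le_lev (l1P x j h); rewrite lerN2 lerDl ler0n.
  by apply: le_lev (l2P j h); rewrite lerN2 lerDr ler0n.
have [l lP] := choice level.
have le_l i : (i <= k)%N -> (l i <= \max_(j < k.+1) l j)%N.
  by move=> le_ik; apply: (leq_bigmax (Ordinal (le_ik : (i < k.+1)%N))).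
move: (\max_(j < k.+1) l j)%N le_l => L le_l.
have {lP le_l l level}lP i : (i <= k)%N ->
    (forall x, mlev (- L%:R) (a i.+1 x : 'rV[ZT]_(m i))) /\ mlev (- L%:R) (E i).
  move=> le_ik; have [aP EP] := lP i le_ik; split=> [x|] j h.
    by apply: le_lev (aP x j h); rewrite lerN2 ler_nat le_l.
  by apply: le_lev (EP j h); rewrite lerN2 ler_nat le_l.
have [c cP] := uniform lt_kn (- L%:R).
have [N NP] := nat_above ((L + c)%:R / chi t).
have {}NP : (L + c)%:R <= N%:R * chi t by rewrite -ler_pdivrMr.
have LN : L%:R <= N%:R * chi t by apply: le_trans NP; rewrite ler_nat leq_addr.
have cN : c%:R <= N%:R * chi t by apply: le_trans NP; rewrite ler_nat leq_addl.
pose g j := (t ^+ (N * (k.+2 - j)))%g.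
have chi_g j : (j <= k)%N -> chi (g j) = chi (g j.+1) + N%:R * chi t.
  move=> le_jk; rewrite /g !charX subSn; last exact: leq_trans le_jk (leqnSn k).
  by rewrite subSS mulnS natrD mulrDl addrC.
have chi_g_ge j : (j <= k.+1)%N -> N%:R * chi t <= chi (g j).
  move=> le_jk; rewrite /g charX ler_wpM2r ?(ltW t_gt0) // ler_nat leq_pmulr //.
  by rewrite subn_gt0.
pose C := mx_obj (trivial_module M : lmodType ZM) m.
pose J i : {linear C i -> resmod chi (F i)} :=
  if i is j.+1 return {linear C i -> resmod chi (F i)}
  then @shift_row T R chi (g j) (m j) else mk_linear triv_res_linear.
have J_inj i : injective (J i).
  by case: i => [|j] x y //; apply: shift_row_inj.
have aJ i : exists al : {linear Q i -> C i}, (i <= k.+1)%N -> forall x, J i (al x) = a i x.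
  case: i => [|j]; first by exists idfun => _ x; rewrite a0.
  have [le_jk|nle] := boolP (j.+1 <= k.+1)%N; last by exists \0.
  have [x|al alP] := @can_lifting _ _ j _ _ (J j.+1) (a j.+1); last by exists al => _.
  apply: shift_row_ex => i' h; apply: le_lev ((lP j le_jk).1 x i' h).
  by rewrite lerN2; apply: le_trans LN (chi_g_ge j _); apply: ltnW.
have dJ i : exists dC : {linear C i.+1 -> C i}, (i <= k.+1)%N ->
    forall x, J i (dC x) = d i (J i.+1 x).
  have [le_ik|nle] := boolP (i <= k.+1)%N; last by exists \0.
  have [x|dC dCP] := @lifting_row _ (m i) _ _ (J i) (@resmap _ _ chi _ _ (d i) \o J i.+1);
    last by exists dC => _.
  case: i le_ik x => [|j] le_jk x; first by exists (d 0%N (J 1%N x)).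
  have Jx : mlev (- chi (g j)) ((shift_row (g j.+1) x : 'rV[ZT]_(m j.+1)) *m E j).
    have := mlevM (@mlev_shift_row _ _ chi (g j.+1) _ x) (lP j le_jk).2.
    move=> lev_prod i' h; apply: le_lev (lev_prod i' h).
    by rewrite chi_g // opprD lerD2l lerN2.
  exact: shift_row_ex Jx.
(* The differential of C and the map from Q to C are those of F, read through
   the injections J. *)
pose al i := sval (cid (aJ i)); pose dC i := sval (cid (dJ i)).
have alP i x : (i <= k.+1)%N -> J i (al i x) = a i x.
  by move=> le_ik; apply: (svalP (cid (aJ i)) le_ik).
have dCP i x : (i <= k.+1)%N -> J i (dC i x) = d i (J i.+1 x).
  by move=> le_ik; apply: (svalP (cid (dJ i)) le_ik).
move: al alP dC dCP => al alP dC dCP {aJ dJ}.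
have lek i : (i <= k)%N -> (i <= k.+1)%N by move/leq_trans; apply.
apply: (@comparison_fg _ k Q C dQ dC al idfun).
- by move=> i _; apply: can_lifting.
- by move=> i _; apply: lifting_row.
- exact: can_diff0S.
- by move=> i x; apply/can_exact; exists x.
- by move=> i x _ /can_exact.
- move=> i x le_ik; apply: J_inj; rewrite (dCP i) ?lek // (dCP i.+1) // linear0.
  exact: dd.
- move=> i x le_ik; apply: J_inj; rewrite dCP ?lek // (alP i) ?lek // (alP i.+1) //.
  by apply: da; apply: leq_trans le_ik (ltnW lt_kn).
- by move=> x; have := alP 0%N x isT; rewrite a0.
- move=> z z0.
  have [y0 y0P] : exists y, d k.+1 y = a k.+1 z.
    by apply: ex_d => //; rewrite da ?(ltnW lt_kn) // z0 linear0.
  have [|y yc yP] := cP (a k.+1 z) ((lP k (leqnn k)).1 z).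
    by exists y0.
  have [b bP] : exists b, J k.+2 b = y.
    apply: shift_row_ex => i' h; apply: le_lev (yc i' h).
    by rewrite lerN2; apply: le_trans cN (chi_g_ge _ _).
  exists b; apply: J_inj; have := dCP k.+1 b (leqnn _); rewrite bP => ->.
  by have := alP k.+1 z (leqnn _) => ->; apply: esym yP.
- by apply: fin_free_fg; apply: IH => //; apply: ltnW.
- exact/fin_free_fg/fin_free_row.
Qed.

End Assembly.

(** * Wreath products *)

(** What the argument uses of a wreath product.  For the wreath product, K k is
    the copy of H that contains y_k. *)
Theorem commuting_colours_type_FP (T : groupType) (R : realType)
    (chi : character T R) (n : nat) (S : set T) (y : nat -> T)
    (K : nat -> set T) :
  (forall s, S s -> 0 < chi s) ->
  (forall g s, S s -> S (conjg s g)) ->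
  (forall k, (k <= n)%N -> S (y k)) ->
  (forall k s, (k <= n)%N -> S s -> ~ K k s -> commute (y k) s) ->
  (forall k, (k <= n)%N -> K k (y k)) ->
  (forall k l s, (k <= n)%N -> (l <= n)%N -> S s -> K k s -> K l s -> k = l) ->
  group_type_FP n T ->
  type_FP n (trivial_module (char_monoid chi)
               : lmodType (monoid_ring (char_monoid chi))).
Proof.
move=> S_gt0 SJ Sy yC Ky K1 /type_FP_can fin.
have [a|i x|i x|m [eps [E [d0S dd ex_d]]]] := @matrix_complex _ n
  (can_obj (trivial_module T : lmodType (monoid_ring T))) (can_diff _) fin.
- exact: can_diff0S.
- by apply/can_exact; exists x.
- by move/can_exact.
apply: (type_FP_char_monoid (S_gt0 _ (Sy 0%N (leq0n n))) d0S dd ex_d).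
move=> i lt_in; apply: (uniform_lifting S_gt0) => D f bijD f0.
apply: (Ext_vanishing SJ Sy yC Ky K1 _ _ dd ex_d bijD lt_in f0).
  by move=> g z; apply: triv_scaleU.
by move=> j _; apply: lifting_row.
Qed.

Section WreathCopies.
Variables (H G : groupType) (X : choiceType) (a : gaction G X).
Local Notation W := (wreath H a).

Lemma wr_copy1 x : wr_copy a x (1%g : H) = 1%g.
Proof.
by apply: (mulgI (wr_copy a x 1%g)); rewrite mulg1 -wr_copyM mulg1.
Qed.

Lemma wr_copy_commute x z (h k : H) : x != z ->
  commute (wr_copy a x h) (wr_copy a z k).
Proof.
move=> xz; congr Wreath; apply/fsfunP => w.
rewrite /= !ds_act1 !ds_mulE !fsfun_withE !ds_oneE.
by case: (w =P x) => [->|_]; rewrite ?(negPf xz) ?mulg1 ?mul1g.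
Qed.

(** The conjugate of the copy of h at x by g = u g' is the copy of the conjugate
    of h by u x, at the preimage of x under g'. *)
Lemma wr_copy_conj x (h : H) (g : W) : exists z k,
  conjg (wr_copy a x h) g = wr_copy a z k.
Proof.
pose z := a (wr_top g)^-1%g x; pose k := conjg h (wr_base g x).
exists z, k; suff -> : conjg (wr_copy a x h) g = (g^-1 * (g * wr_copy a z k))%g.
  by rewrite mulKg.
rewrite conjgE; congr (_ * _)%g; congr Wreath; last by rewrite /= mul1g mulg1.
apply/fsfunP => w; rewrite /= ds_act1 !ds_mulE ds_actE !fsfun_withE !ds_oneE.
rewrite (can_eq (gactVK a (wr_top g))).
by case: eqP => [->|_]; rewrite ?mulg1 ?mul1g // /k conjgE mulVKg.
Qed.

Lemma wr_copy_index x z (h k : H) :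
  wr_copy a x h = wr_copy a z k -> wr_copy a x h != 1%g -> x = z.
Proof.
move=> hk; apply: contraNeq => xz; suff -> : h = 1%g by rewrite wr_copy1.
have /fsfunP/(_ x) := congr1 (@wr_base _ _ _ _) hk.
by rewrite !fsfun_withE eqxx (negPf xz) ds_oneE.
Qed.

End WreathCopies.

Theorem corollary1p6 (R : realType) (n : nat) (H G : groupType)
    (X : choiceType) (a : gaction G X) (chi : character (wreath H a) R) :
  (1 <= n)%N ->
  group_type_FP n (wreath H a) ->
  `I_n.+1 #<= wr_char_support chi ->
  Sigma n (char_class chi).
Proof.
move=> _ fpW /card_leP[f].
split; first by exists chi.
exists chi => //.
pose x k : X := val (f (exist _ (val (inord k : 'I_n.+1)) (mem_set (ltn_ord _)))).
have x_inj k l : (k <= n)%N -> (l <= n)%N -> x k = x l -> k = l.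
  move=> kn ln /val_inj /(@inj _ _ _ f _ _ (in_setT _) (in_setT _)) [].
  by rewrite !inordK.
have ex_pos k : exists h, 0 < chi (wr_copy a (x k) h).
  have [h h0] : wr_char_support chi (x k) by apply/set_mem/(valP (f _)).
  have [hgt|hle] := ltP 0 (chi (wr_copy a (x k) h)); first by exists h.
  exists (h^-1)%g; have := charM chi (wr_copy a (x k) h) (wr_copy a (x k) (h^-1)%g).
  rewrite -wr_copyM mulgV wr_copy1 char1 => /eqP.
  rewrite eq_sym addrC addr_eq0 => /eqP ->.
  by rewrite oppr_gt0 lt_neqAle h0.
have [h h_gt0] := choice ex_pos.
pose S : set (wreath H a) :=
  [set s | (exists z k, s = wr_copy a z k) /\ 0 < chi s].
pose K k : set (wreath H a) := [set s | exists k', s = wr_copy a (x k) k'].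
have S_neq1 s : S s -> s != 1%g.
  by move=> [_ s_gt0]; apply: contraTneq s_gt0 => ->; rewrite char1 ltxx.
apply: (@commuting_colours_type_FP _ _ _ n S (fun k => wr_copy a (x k) (h k)) K) => //.
- by move=> s [].
- move=> g s [[z [k ->]] s_gt0]; split; last by rewrite char_conj.
  by have [z' [k' ->]] := wr_copy_conj z k g; exists z', k'.
- by move=> k _; split=> //; exists (x k), (h k).
- move=> k s _ [[z [k' ->]] _] nK; apply: wr_copy_commute.
  by apply: contra_notN nK => /eqP xz; exists k'; rewrite xz.
- by move=> k _; exists (h k).
move=> k l s kn ln Ss [k1 s1] [k2 s2]; apply: x_inj => //.
by apply: (@wr_copy_index _ _ _ a _ _ k1 k2); rewrite -s1 //; apply: S_neq1.
Qed.
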